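(* Let $n\ge 2$ and $0<a<1$. Suppose $u\in C^2(\mathbb{R}^n_+)\cap C^1(\overline{\mathbb{R}^n_+})$ satisfies $\operatorname{div}(x_n^a\nabla u)=0$ and $u>0$ in $\mathbb{R}^n_+$. Then $u=C$ for some positive constant $C$.
   Context: $\mathbb{R}^n_+=\{x=(x',x_n)\in\mathbb{R}^n: x_n>0\}$ is the open upper half space and $\overline{\mathbb{R}^n_+}=\{x_n\ge 0\}$. No condition on the boundary values of $u$ is assumed. *)

(* Defs.v *)
From HB Require Import structures.
From mathcomp Require Import all_boot all_order all_algebra.
From mathcomp Require Import all_classical all_reals all_analysis.

Set Implicit Arguments.
Unset Strict Implicit.
Unset Printing Implicit Defensive.

Import Order.TTheory GRing.Theory Num.Theory.
Import numFieldNormedType.Exports.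

Local Open Scope classical_set_scope.
Local Open Scope ring_scope.

(* Points of R^m are row vectors 'rV[R]_m. The library norm on them is the
   max norm, which induces the usual topology. *)

Section calculus.
Context {R : realType} {m : nat}.
Implicit Types (D : set 'rV[R]_m) (f : 'rV[R]_m -> R).

Definition partial (i : 'I_m) f : 'rV[R]_m -> R := 'D_(delta_mx 0 i) f.

Definition grad f (x : 'rV[R]_m) : 'rV[R]_m := \row_i partial i f x.

Definition div (F : 'rV[R]_m -> 'rV[R]_m) (x : 'rV[R]_m) : R :=
  \sum_(i < m) partial i (fun y => F y 0 i) x.

(* C^k(D) for an open set D; f is a total function, but only its values on D
   matter. *)
Fixpoint Ck (k : nat) D f : Prop :=
  {in D, continuous f} /\
  if k is k'.+1 then
    forall i : 'I_m,
      {in D, forall x, derivable f x (delta_mx 0 i)} /\ Ck k' D (partial i f)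
  else True.

(* C^1 up to the boundary of the open set D: f is continuous on the closure
   of D, and each first-order partial derivative, which is only taken inside
   D, has a continuous extension to the closure of D. *)
Definition C1_closure D f : Prop :=
  [/\ Ck 1 D f,
      {within closure D, continuous f} &
      forall i : 'I_m, exists2 g : 'rV[R]_m -> R,
        {within closure D, continuous g} & {in D, partial i f =1 g}].

End calculus.

Section half_space.
Context (R : realType) (n : nat).

Definition half_space : set 'rV[R]_n.+1 := [set x | 0 < x 0 ord_max].

Definition closed_half_space : set 'rV[R]_n.+1 := [set x | 0 <= x 0 ord_max].

Lemma closure_half_space : closure half_space = closed_half_space.
Proof.
apply/seteqP; split => x.
  have cl : closed closed_half_space.
    rewrite (_ : closed_half_space =
      (fun y : 'rV[R]_n.+1 => y 0 ord_max) @^-1` [set t | 0 <= t]) //.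
    apply: (@preimage_closed _ R); last exact: (@closed_ge R 0).
    by move=> y _; exact: (@coord_continuous R).
  move=> hx; apply: cl; apply: closureS hx => y /=; exact: ltW.
rewrite /closed_half_space/= => x0 B /nbhs_ballP[e /= e0 xB].
pose y := x + (e / 2) *: delta_mx 0 ord_max.
exists y; split.
  by rewrite /half_space /y /= !mxE !eqxx mulr1 ltr_wpDl// divr_gt0.
apply: xB; rewrite -ball_normE /= /y opprD addrA subrr add0r normrN normrZ.
rewrite gtr0_norm ?divr_gt0//.
have dle1 : `|delta_mx 0 ord_max : 'rV[R]_n.+1| <= 1.
  rewrite /Num.norm /= mx_normrE; apply/bigmax_leP; split => // i _.
  by rewrite mxE normr_nat; case: (_ && _); rewrite ?ler01 ?lexx.
apply: (@le_lt_trans _ _ (e / 2)).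
  by rewrite -[leRHS]mulr1 ler_wpM2l// divr_ge0// ltW.
by rewrite gtr_pMr// invf_lt1// ltr1n.
Qed.

End half_space.

Arguments half_space : clear implicits.
Arguments closed_half_space : clear implicits.

(* Main.v *)
Require Import Defs.
From HB Require Import structures.
From mathcomp Require Import all_boot all_order all_algebra.
From mathcomp Require Import all_classical all_reals all_analysis.
From mathcomp Require Import ring lra.
Import Order.TTheory GRing.Theory Num.Theory.
Import numFieldNormedType.Exports.
Local Open Scope classical_set_scope.
Local Open Scope ring_scope.

(** Let N = n + 1 be the dimension and write the equation as
    x_N Delta u + a d_N u = 0. The proof is a maximum principle in doubled
    variables; it uses neither integration nor any regularity beyond C^2.

    The heart is a Harnack inequality at unit scale. Put d(x) = 1 - |x|^2,
    r = |x - y|, h(x, y) = d(x) - 8 r and K = 5 N. Then a nonnegative solution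
    satisfies u(x) h(x, y)^K <= u(y) wherever h > 0 ([harnack_unit]). Applied
    to z |-> u(R z) at the points x / R and y / R and letting R tend to
    infinity, h tends to 1, so u(x) <= u(y) for all x and y: u is constant
    ([liouville_le]).

    For the Harnack inequality, suppose that two positive solutions u1 and u2,
    close to u, violate u1(x) h^K <= c u2(y) d(x)^K, where c > 1 and u1 < c u2
    on the diagonal. The ratio u1(x) h^K / (u2(y) d(x)^K) then has a global
    maximum ([ratio_max_exists]), and there x and y differ.

    - The maximum is not on the boundary. The function x_N^(1 - a) is a
      solution with infinite slope at x_N = 0, while u, being C^1 up to the
      boundary, has bounded slope there. So u1 = u + e + k x_N^(1 - a) increases
      and u2 = u + e - k x_N^(1 - a) decreases at an infinite rate when a point
      leaves the boundary, whereas h and d are Lipschitz. This is how the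
      absence of a boundary condition is compensated.

    - The maximum is not interior. The first-order conditions give
      grad (log u1)(x) and grad (log u2)(y). The second-order conditions are
      taken along the lines (x + sg t e_i, y + t e_i), with the two points
      moving in the same direction but with x slightly slower:
      sg = 1 - 4 r / d. Their sum over i contains Delta u1 / u1 and
      Delta u2 / u2, known from the equation, and the quadratic terms
      |grad (log u2)|^2 - sg^2 |grad (log u1)|^2. The difference of speeds
      makes the latter at least 128 K^2 s / h^2, where s = r / d, and all the
      other terms are of order N K s / h^2. This is contradictory for K = 5 N
      ([no_interior_max]).

    All derivatives are taken along coordinate lines, so solutions are
    described by second-order jets of functions of one variable. *)

(** * Second-order jets of functions of one variable *)

Section jets.
Context {R : realType}.
Implicit Types (g f : R -> R).

(** Differentiability of the derivative is required at 0 only: this is what a C^2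
    hypothesis provides along a line, and what the second derivative test needs. *)
Definition jet2 g (p s : R) :=
  exists g1 : R -> R,
    [/\ \forall t \near (0 : R), is_derive (t : R) 1 g (g1 t),
        g1 0 = p & is_derive (0 : R) 1 g1 s].

Lemma jet2_continuous g p s : jet2 g p s -> {for (0 : R), continuous g}.
Proof.
move=> [g1 [/nbhs_singleton hd _ _]].
by apply/differentiable_continuous/derivable1_diffP.
Qed.

Lemma jet2_max g p s : jet2 g p s -> (\forall t \near (0 : R), g t <= g 0) ->
  p = 0 /\ s <= 0.
Proof.
move=> [g1 [hd g10 hs]] hmax.
have [e /= e0 he] : exists2 e : R, 0 < e & forall t, `|t| < e ->
    is_derive (t : R) 1 g (g1 t) /\ g t <= g 0.
  have : \forall t \near (0 : R), is_derive (t : R) 1 g (g1 t) /\ g t <= g 0.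
    by apply: filterS2 hd hmax => t.
  move=> /nbhs_ballP[e /= e0 he].
  by exists e => // t te; apply: he; rewrite -ball_normE /= sub0r normrN.
have inE' t : t \in `]- e, e[%R -> `|t| < e by rewrite in_itv /= ltr_norml.
have p0 : p = 0.
  have z : (0 : R) \in `]- e, e[%R by rewrite in_itv /= oppr_lt0 e0.
  have [] := @derive1_at_max _ g (- e) e 0 _ _ z _.
  - by rewrite ge0_cp // ltW.
  - by move=> t /inE' /he [[]].
  - by move=> t /inE' /he [].
  move=> _ <-; rewrite -g10.
  by have [[_ <-] _] := he 0 ltac:(by rewrite normr0).
split=> //; rewrite leNgt; apply/negP => s0.
(* with a positive second derivative, g would increase to the right of 0 *)
have [t [t0 te g1pos]] : exists t, [/\ 0 < t, t < e &
    forall c, 0 < c < t -> 0 < g1 c].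
  case: hs => hs1 hs2.
  have cv : (fun h : R => h^-1 *: ((g1 \o shift 0) (h *: 1) - g1 0)) @ 0^' --> s.
    by rewrite -hs2; exact: hs1.
  have := cv _ (@lt_nbhsr _ 0 s s0).
  move=> /nbhs_ballP[d /= d0 hd'].
  exists (Num.min d e / 2); split.
  - by rewrite divr_gt0 // lt_min d0.
  - by rewrite ltr_pdivrMr // gt_min; apply/orP; right; lra.
  move=> c /andP[c0 cd].
  have cd' : c < d by apply: (lt_le_trans cd); rewrite ler_pdivrMr // ge_min; apply/orP; left; lra.
  have := hd' c; rewrite -ball_normE /= sub0r normrN gtr0_norm // => /(_ cd').
  rewrite gt_eqF // => /(_ isT); rewrite /= addr0 g10 p0 subr0 [_%:A]mulr1.
  by rewrite pmulr_rgt0 // invr_gt0.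
have [||c] := @MVT _ g g1 0 t t0.
- by move=> x; rewrite in_itv /= => /andP[x0 xt];
    have [] := he x ltac:(by rewrite gtr0_norm // (lt_trans xt)).
- apply: derivable_within_continuous => x; rewrite in_itv /= => /andP[x0 xt].
  by have [[]] := he x ltac:(by rewrite ger0_norm // (le_lt_trans xt)).
rewrite in_itv /= subr0 => /g1pos c0 gE.
have [_] := he t ltac:(by rewrite gtr0_norm).
by rewrite -subr_le0 gE leNgt mulr_gt0.
Qed.

Lemma jet2D g f p q s r : jet2 g p s -> jet2 f q r ->
  jet2 (fun t => g t + f t) (p + q) (s + r).
Proof.
move=> [g1 [hg g10 hs]] [f1 [hf f10 hr]].
exists (g1 \+ f1); split.
- by near=> t; apply: is_deriveD; near: t.
- by rewrite /= g10 f10.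
- exact: is_deriveD.
Unshelve. all: by end_near. Qed.

Lemma jet2Z k g p s : jet2 g p s -> jet2 (fun t => k * g t) (k * p) (k * s).
Proof.
move=> [g1 [hg g10 hs]]; exists (k \*: g1); split.
- by near=> t; apply: is_deriveZ; near: t.
- by rewrite /= g10.
- exact: is_deriveZ.
Unshelve. all: by end_near. Qed.

Lemma jet2_quad c0 c1 c2 :
  jet2 (fun t => c0 + c1 * t + c2 * t ^+ 2) c1 (2 * c2).
Proof.
exists (fun t => c1 + 2 * c2 * t); split; last 2 first.
- by rewrite mulr0 addr0.
- apply: is_derive_eq; rewrite /GRing.scale /=; ring.
near=> t; apply: is_derive_eq; rewrite /GRing.scale /=; ring.
Unshelve. all: by end_near. Qed.

Lemma jet2_scale k g p s : jet2 g p s ->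
  jet2 (fun t => g (k * t)) (k * p) (k ^+ 2 * s).
Proof.
move=> [g1 [hg g10 hs]]; exists (fun t => k * g1 (k * t)).
have hk (t : R) : is_derive t 1 (fun t => k * t) k.
  by apply: is_derive_eq; rewrite /GRing.scale /=; ring.
have h0 : (fun t => k * t) @ (0 : R) --> (0 : R).
  by rewrite -[X in _ --> X](mulr0 k); apply: mulrl_continuous.
split.
- have hg' : \forall t \near (0 : R), is_derive (k * t : R) 1 g (g1 (k * t)).
    exact: h0 _ hg.
  near=> t; have ht : is_derive (k * t : R) 1 g (g1 (k * t)) by near: t.
  have := @is_derive1_comp _ g (fun t => k * t) t _ _ ht (hk t).
  by rewrite mulrC.
- by rewrite mulr0 g10.
- have hs' : is_derive (k * 0 : R) 1 g1 s by rewrite mulr0.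
  have := @is_deriveZ _ _ _ _ k (0:R) 1 _ (@is_derive1_comp _ g1 (fun t => k * t) 0 _ _ hs' (hk 0)).
  by congr is_derive; rewrite /GRing.scale /=; ring.
Unshelve. all: by end_near. Qed.

Lemma jet2_ln g p s : 0 < g 0 -> jet2 g p s ->
  jet2 (fun t => ln (g t)) (p / g 0) (s / g 0 - (p / g 0) ^+ 2).
Proof.
move=> g0 j; have cg := jet2_continuous _ _ _ j.
have gpos : \forall t \near (0 : R), 0 < g t.
  exact: (cg _ (lt_nbhsr g0)).
move: j => [g1 [hg g10 hs]]; exists (fun t => g1 t / g t); split.
- near=> t.
  have gt0 : 0 < g t by near: t.
  have ht : is_derive (t : R) 1 g (g1 t) by near: t.
  have hl := is_derive1_ln gt0.
  have := @is_derive1_comp _ (@ln R) g t _ _ hl ht.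
  by rewrite mulrC.
- by rewrite g10.
- have hg0 := nbhs_singleton hg.
  have hv := @is_deriveV _ g (0:R) (g1 0) 1 (lt0r_neq0 g0) hg0.
  have := is_deriveM hs hv.
  congr is_derive; rewrite /GRing.scale /= g10 -!exprVn; field.
  by rewrite gt_eqF.
Unshelve. all: by end_near. Qed.

Lemma jet2_cst (k : R) : jet2 (fun=> k) 0 0.
Proof.
exists (fun=> 0); split=> //; last exact: is_derive_cst.
by near=> t; exact: is_derive_cst.
Unshelve. all: by end_near. Qed.

Lemma jet2_powR (b t0 : R) : 0 < t0 ->
  jet2 (fun t => (t0 + t) `^ b) (b * t0 `^ (b - 1)) (b * ((b - 1) * t0 `^ (b - 1 - 1))).
Proof.
move=> t00.
have der (b' t : R) : 0 < t0 + t ->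
    is_derive t 1 (fun t => (t0 + t) `^ b') (b' * (t0 + t) `^ (b' - 1)).
  move=> pos; have h := @is_derive1_powR R b' (t0 + t) pos.
  have h2 : is_derive t 1 (fun t => t0 + t) 1.
    have h3 := is_deriveD (is_derive_cst t0 t (1 : R)) (is_derive_id t (1 : R)).
    by rewrite add0r in h3.
  have := @is_derive1_comp R (fun s : R => s `^ b') (fun s : R => t0 + s) t _ _ h h2.
  by rewrite mulr1.
exists (fun t => b * (t0 + t) `^ (b - 1)); split.
- near=> t; apply: der.
  have : - t0 < t by near: t; apply: lt_nbhsr; rewrite oppr_lt0.
  by rewrite -subr_gt0 opprK addrC.
- by rewrite addr0.
- have pos : 0 < t0 + 0 by rewrite addr0.
  have := @is_deriveZ _ _ _ _ b (0 : R) 1 _ (der (b - 1) 0 pos).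
  by rewrite /GRing.scale /= addr0.
Unshelve. all: by end_near. Qed.

(** Because t = t^a t^(1 - a), where t^a tends to 0. *)
Lemma powR_steep (a e C : R) : 0 < a -> 0 < e ->
  \forall t \near (0 : R)^'+, C * t <= e * t `^ (1 - a).
Proof.
move=> a0 e0; have C0 : 0 < `|C| + 1 by rewrite ltr_pwDr.
have d0 : 0 < e / (`|C| + 1) by rewrite divr_gt0.
near=> t.
have t0 : 0 < t by near: t; exact: nbhs_right_gt.
have ta : t `^ a < e / (`|C| + 1).
  near: t; have := powR_cvg0 a0; move=> /(_ _ (lt_nbhsl d0)); exact.
have tE : t = t `^ a * t `^ (1 - a).
  rewrite -powRD; last by apply/implyP => _; rewrite gt_eqF.
  by rewrite addrC subrK powRr1 // ltW.
apply: (@le_trans _ _ ((`|C| + 1) * t)).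
  by rewrite ler_wpM2r ?(ltW t0) // (le_trans (ler_norm C)) // lerDl.
rewrite {1}tE mulrA ler_wpM2r ?powR_ge0 //.
by rewrite mulrC -ler_pdivlMr // ltW.
Unshelve. all: by end_near. Qed.

End jets.

(** The logarithm of g1 H^K / (g2 d^K) is a sum of jets, to which the second
    derivative test applies. The maximum is expressed without quotients so that only
    the values at 0 have to be known to be positive. *)
Lemma log_ratio_jets {R : realType} (K : nat) (M : R) (g1 g2 H d : R -> R)
    (a1 b1 a2 b2 aH bH ad bd : R) :
  jet2 g1 a1 b1 -> jet2 g2 a2 b2 -> jet2 H aH bH -> jet2 d ad bd ->
  0 < g1 0 -> 0 < g2 0 -> 0 < H 0 -> 0 < d 0 ->
  (\forall t \near (0 : R), g1 t * H t ^+ K <= M * (g2 t * d t ^+ K)) ->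
  g1 0 * H 0 ^+ K = M * (g2 0 * d 0 ^+ K) ->
  a1 / g1 0 + K%:R * (aH / H 0) = a2 / g2 0 + K%:R * (ad / d 0) /\
  (b1 / g1 0 - (a1 / g1 0) ^+ 2) + K%:R * (bH / H 0 - (aH / H 0) ^+ 2) <=
  (b2 / g2 0 - (a2 / g2 0) ^+ 2) + K%:R * (bd / d 0 - (ad / d 0) ^+ 2).
Proof.
move=> j1 j2 jH jd p1 p2 pH pd hle heq.
have near_pos g p q (j : jet2 g p q) : 0 < g 0 -> \forall t \near (0 : R), 0 < g t.
  by move=> g0; exact: (jet2_continuous _ _ _ j _ (lt_nbhsr g0)).
have M0 : 0 < M.
  have : 0 < M * (g2 0 * d 0 ^+ K) by rewrite -heq mulr_gt0 // exprn_gt0.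
  by rewrite pmulr_lgt0 // mulr_gt0 // exprn_gt0.
have := jet2D _ _ _ _ _ _
  (jet2D _ _ _ _ _ _ (jet2_ln _ _ _ p1 j1) (jet2Z K%:R _ _ _ (jet2_ln _ _ _ pH jH)))
  (jet2Z (-1) _ _ _ (jet2D _ _ _ _ _ _ (jet2_ln _ _ _ p2 j2)
  (jet2Z K%:R _ _ _ (jet2_ln _ _ _ pd jd)))).
move=> /jet2_max[|].
  near=> t.
  have q1 : 0 < g1 t by near: t; exact: near_pos j1 p1.
  have q2 : 0 < g2 t by near: t; exact: near_pos j2 p2.
  have qH : 0 < H t by near: t; exact: near_pos jH pH.
  have qd : 0 < d t by near: t; exact: near_pos jd pd.
  have hb : g1 t * H t ^+ K <= M * (g2 t * d t ^+ K) by near: t.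
  have lnK (x : R) : 0 < x -> K%:R * ln x = ln (x ^+ K).
    by move=> x0; rewrite lnXn // mulr_natl.
  have lnE (x y : R) : 0 < x -> 0 < y -> ln x + K%:R * ln y = ln (x * y ^+ K).
    by move=> x0 y0; rewrite lnK // lnM // posrE ?exprn_gt0.
  rewrite !lnE // !mulN1r heq [ln (M * (g2 0 * _))]lnM ?posrE ?mulr_gt0 ?exprn_gt0 // addrK.
  rewrite lerBlDr -lnM ?posrE ?mulr_gt0 ?exprn_gt0 //.
  by rewrite ler_ln ?posrE ?mulr_gt0 ?exprn_gt0.
by rewrite !mulN1r subr_le0 => /eqP; rewrite subr_eq0 => /eqP.
Unshelve. all: by end_near. Qed.

(** * The inequality that excludes an interior maximum *)

Section scalar.
Context {R : realFieldType}.
Implicit Types s sg h A c N K D : R.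

(** The squared gradients: |grad (log u1)|^2 is 64 K^2 / h^2 times
    |e + 2 s x|^2 <= (1 + 2 s)^2, with e the unit vector from y to x. Slowing x
    down by the factor 1 - 4 s beats the factor 1 + 2 s, with a margin
    proportional to s. *)
Lemma gain_bound s A c : 0 < s -> 8 * s < 1 -> A <= 1 -> c <= 1 ->
  (1 - 4 * s) ^+ 2 * (256 * s ^+ 2 * A + 256 * s * c + 64) <= 64 - 128 * s.
Proof.
move=> s0 s8 A1 c1.
have s2 : 0 <= s ^+ 2 by exact: sqr_ge0.
have s3 : 8 * s ^+ 2 <= s.
  by rewrite expr2 mulrA ler_piMl // ltW.
have hA : s ^+ 2 * A <= s ^+ 2 by rewrite ler_piMr.
have hc : s * c <= s by rewrite ler_piMr // ltW.
have e : 256 * s ^+ 2 * A + 256 * s * c + 64 <= 64 * (1 + 2 * s) ^+ 2.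
  rewrite (_ : (1 + 2 * s) ^+ 2 = 1 + 4 * s + 4 * s ^+ 2); last by ring.
  rewrite -!mulrA; lra.
apply: (le_trans (ler_wpM2l (sqr_ge0 _) e)).
rewrite (_ : (1 - 4 * s) ^+ 2 * _ = 64 * (1 - 2 * s - 8 * s ^+ 2) ^+ 2); last by ring.
have : (1 - 2 * s - 8 * s ^+ 2) ^+ 2 <= 1 - 2 * s - 8 * s ^+ 2.
  by rewrite expr2 ler_piMr //; lra.
lra.
Qed.

(** The remaining terms, which come from the second derivatives of log h and
    log d. Each of them vanishes at least linearly in s: 1 / h - 1 / d is
    8 s / h, and the relative speed 4 s contributes (4 s)^2 / r = 16 s / d. *)
Lemma loss_bound s h A c N : 0 < s -> 8 * s < 1 -> 0 < h -> h <= 1 -> 1 <= N ->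
  0 <= A -> A <= 1 -> - 1 <= c -> c <= 1 ->
  - (144 * N * s) - 320 * s <=
    N * (- (16 * (1 - 4 * s) ^+ 2 * s * h) - 128 * s * (1 - 8 * s))
    - 4 * (1 - 4 * s) ^+ 2 * A * (16 * s - 64 * s ^+ 2)
    + 128 * (1 - 4 * s) * s * c - 1024 * s ^+ 2.
Proof.
move=> s0 s8 h0 h1 N1 A0 A1 c0 c1.
have sg2 : (1 - 4 * s) ^+ 2 <= 1 by rewrite expr_le1 //; lra.
have sg0 : 0 <= (1 - 4 * s) ^+ 2 by exact: sqr_ge0.
have s2 : 0 <= s ^+ 2 by exact: sqr_ge0.
have s3 : 8 * s ^+ 2 <= s by rewrite expr2 mulrA ler_piMl // ltW.
have e2 : (1 - 4 * s) ^+ 2 * h * s <= 1 * s.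
  by apply: ler_wpM2r (ltW s0) _ _ _; rewrite mulr_ile1 // ltW.
have e4 : (1 - 4 * s) ^+ 2 * A * (16 * s - 64 * s ^+ 2) <= 1 * (16 * s).
  apply: ler_pM; [exact: mulr_ge0|lra| |lra].
  by rewrite mulr_ile1.
have e5 : - s <= (1 - 4 * s) * c * s.
  have : `|(1 - 4 * s) * c| <= 1.
    rewrite normrM mulr_ile1 // ler_norml ?c0 //.
    by apply/andP; split; lra.
  by rewrite ler_norml => /andP[/(ler_wpM2r (ltW s0)) + _]; rewrite mulN1r.
have e7 : N * (16 * ((1 - 4 * s) ^+ 2 * h * s) + 128 * s * (1 - 8 * s)) <= N * (144 * s).
  rewrite ler_wpM2l //; first lra.
  have : s * (1 - 8 * s) <= s * 1 by rewrite ler_wpM2l //; lra.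
  rewrite -mulrA; lra.
move: e4 e5 e7; clear e2; set q := (1 - 4 * s) ^+ 2 => e4 e5 e7.
rewrite (_ : N * (- _ - _) = - (N * (16 * (q * h * s) + 128 * s * (1 - 8 * s)))); last by ring.
rewrite (_ : 4 * q * A * _ = 4 * (q * A * (16 * s - 64 * s ^+ 2))); last by ring.
rewrite (_ : 128 * _ * s * c = 128 * ((1 - 4 * s) * c * s)); last by ring.
rewrite (_ : 144 * N * s = N * (144 * s)); last by ring.
move: e4 e5 e7 s2 s3; set X := q * A * _; set Y := _ * c * s.
set Z := N * _; set W := N * _; set S := s ^+ 2.
clearbody X Y Z W S => *; lra.
Qed.

(** A and c stand for |x|^2 and x . e, and D for the drift terms multiplied by
    h^2. The gain 128 K^2 s exceeds the losses
    K s (144 + 144 N + 320) because 640 N > 144 N + 464. *)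
Lemma no_interior_max_scalar (N K s h A c sg D : R) :
  0 < s -> 8 * s < 1 -> 0 < h -> h <= 1 -> 1 <= N -> K = 5 * N ->
  0 <= A -> A <= 1 -> - 1 <= c -> c <= 1 -> sg = 1 - 4 * s ->
  - (144 * K * s) <= D ->
  ~ (D - sg ^+ 2 * K ^+ 2 * (256 * s ^+ 2 * A + 256 * s * c + 64)
     + K * (N * (- (16 * sg ^+ 2 * s * h) - 128 * s * (1 - 8 * s))
            - 4 * sg ^+ 2 * A * (16 * s - 64 * s ^+ 2)
            + 128 * sg * s * c - 1024 * s ^+ 2) + 64 * K ^+ 2 <= 0).
Proof.
move=> s0 s8 h0 h1 N1 KE A0 A1 c0 c1 -> hD.
have K0 : 0 < K by rewrite KE; lra.
have hB := ler_wpM2l (ltW K0) (loss_bound _ _ _ _ _ s0 s8 h0 h1 N1 A0 A1 c0 c1).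
have hC := ler_wpM2l (sqr_ge0 K) (gain_bound _ _ _ s0 s8 A1 c1).
have n0 : 0 < 496 * N - 464 by lra.
have pos := mulr_gt0 K0 (mulr_gt0 s0 n0).
have posE : K * (s * (496 * N - 464)) = - (144 * K * s) - K ^+ 2 * (64 - 128 * s)
   + K * (- (144 * N * s) - 320 * s) + 64 * K ^+ 2 by rewrite KE; ring.
rewrite posE in pos.
apply/negP; rewrite -ltNge; apply: (lt_le_trans pos).
rewrite lerD2r lerD // [X in _ <= D - X](_ : _ = K ^+ 2 *
  ((1 - 4 * s) ^+ 2 * (256 * s ^+ 2 * A + 256 * s * c + 64))); last by ring.
by rewrite lerB.
Qed.

End scalar.

Section interior.
Context {R : realFieldType}.

(** The first-order term of the equation. It would be singular at the boundary,
    but its singular part is (x_N - sg y_N)^2 / (x_N y_N) up to a positive factor,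
    hence has the good sign: the drift pulls the two points together. *)
Lemma drift_bound (a K s d x y e sg : R) :
  0 < a -> a <= 1 -> 0 < K -> 0 < s -> 8 * s < 1 -> 0 < d -> d <= 1 ->
  0 < x -> 0 < y -> e = (x - y) / (s * d) -> sg = 1 - 4 * s ->
  - (144 * K * s) <= (d * (1 - 8 * s)) ^+ 2 *
    (sg ^+ 2 * (- a * (K * (- (2 * x) / d) - K * ((- (2 * x) - 8 * e) / (d * (1 - 8 * s)))) / x)
     - (- a * (K * (8 * e / (d * (1 - 8 * s)))) / y)).
Proof.
move=> a0 a1 K0 s0 s8 d0 d1 x0 y0 eE sgE.
have h0 : 0 < 1 - 8 * s by lra.
have sg2 : sg ^+ 2 <= 1 by rewrite sgE expr_le1 //; lra.
have -> : (d * (1 - 8 * s)) ^+ 2 *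
    (sg ^+ 2 * (- a * (K * (- (2 * x) / d) - K * ((- (2 * x) - 8 * e) / (d * (1 - 8 * s)))) / x)
     - (- a * (K * (8 * e / (d * (1 - 8 * s)))) / y)) =
   K * a * (1 - 8 * s) * (8 / s * ((x - sg * y) ^+ 2 / (x * y)) - 128 * s - 16 * s * d * sg ^+ 2).
  rewrite eE sgE; field.
  by rewrite !gt_eqF.
have q0 : 0 <= 8 / s * ((x - sg * y) ^+ 2 / (x * y)).
  apply: mulr_ge0; first by rewrite divr_ge0 // ltW.
  by rewrite divr_ge0 ?sqr_ge0 // mulr_ge0 // ltW.
have q1 : s * (d * sg ^+ 2) <= s * 1.
  apply: ler_wpM2l; first exact: ltW.
  by apply: mulr_ile1 => //; [exact: ltW|exact: sqr_ge0].
have c0 : 0 <= a * (1 - 8 * s) by apply: mulr_ge0; apply: ltW.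
have c1 : a * (1 - 8 * s) <= 1 by apply: mulr_ile1; lra.
have q2 : - (144 * s) <= 8 / s * ((x - sg * y) ^+ 2 / (x * y)) - 128 * s - 16 * s * d * sg ^+ 2.
  rewrite -(mulrA (16 * s)) -(mulrA 16 s).
  move: q0 q1; set q := 8 / s * _; set p := s * (d * _).
  clearbody q p => *; lra.
rewrite (_ : - (144 * K * s) = K * (1 * - (144 * s))); last by ring.
rewrite -!(mulrA K) ler_wpM2l ?(ltW K0) //.
apply: le_trans (ler_wpM2l c0 q2).
by rewrite ler_wnM2r // oppr_le0; apply: mulr_ge0 => //; apply: ltW.
Qed.

(** U and V are the unmixed second derivatives of u1 and u2 divided by u1(x) and
    u2(y); P and Q are the logarithmic gradients imposed by the first-order
    conditions. Each second-order inequality is a quadratic form in (x_i, e_i),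
    so its sum over i only involves |x|^2, x . e and |e|^2 = 1. *)
Lemma no_interior_max n (a r d h K sg : R) (x y U V : 'I_n.+1 -> R)
    (e := fun i => (x i - y i) / r)
    (P := fun i => K * (- (2 * x i) / d) - K * ((- (2 * x i) - 8 * e i) / h))
    (Q := fun i => K * (8 * e i / h)) :
  0 < a -> a <= 1 -> 0 < r -> r ^+ 2 = \sum_i (x i - y i) ^+ 2 ->
  d = 1 - \sum_i x i ^+ 2 -> h = d - 8 * r -> 0 < h ->
  K = 5 * n.+1%:R -> sg = 1 - 4 * (r / d) ->
  0 < x ord_max -> 0 < y ord_max ->
  \sum_i U i = - a * P ord_max / x ord_max ->
  \sum_i V i = - a * Q ord_max / y ord_max ->
  ~ (forall i,
      sg ^+ 2 * (U i - P i ^+ 2) +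
        K * ((- (2 * sg ^+ 2) - 8 * (1 - sg) ^+ 2 / r) / h
             - ((- (2 * sg * x i) + 8 * (1 - sg) * e i) / h) ^+ 2) <=
      V i - Q i ^+ 2 +
        K * (- (2 * sg ^+ 2) / d - (- (2 * sg * x i) / d) ^+ 2)).
Proof.
move=> a0 a1 r0 rE dE hE h0 KE sgE xm ym hU hV hi.
have K0 : 0 < K by rewrite KE mulr_gt0.
have d0 : 0 < d by rewrite -(subrK (8 * r) d) -hE addr_gt0 // mulr_gt0.
set A := \sum_i x i ^+ 2 in dE.
have A0 : 0 <= A by apply: sumr_ge0 => i _; exact: sqr_ge0.
pose c := \sum_i x i * e i.
have e1 : \sum_i e i ^+ 2 = 1.
  under eq_bigr do rewrite expr_div_n.
  by rewrite -mulr_suml -rE divff // expf_neq0 // gt_eqF.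
have cb (t : R) : 0 <= A + 2 * t * c + t ^+ 2.
  have -> : A + 2 * t * c + t ^+ 2 = \sum_i (x i + t * e i) ^+ 2.
    have {1}-> : t ^+ 2 = \sum_i t ^+ 2 * e i ^+ 2 by rewrite -mulr_sumr e1 mulr1.
    rewrite mulr_sumr -!big_split /=.
    by apply: eq_bigr => i _; ring.
  by apply: sumr_ge0 => i _; exact: sqr_ge0.
have [s sE] : exists s, s = r / d by exists (r / d).
have s0 : 0 < s by rewrite sE divr_gt0.
have rsd : r = s * d by rewrite sE divfK // gt_eqF.
rewrite -sE in sgE.
have hds : h = d * (1 - 8 * s) by rewrite hE rsd; ring.
have s8 : 8 * s < 1 by move: h0; rewrite hds pmulr_rgt0 // subr_gt0.
have hd1 : h <= 1.
  have : 0 <= 8 * r by rewrite mulr_ge0 // ltW.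
  by move: hE dE A0; lra.
have d1 : d <= 1 by rewrite dE; lra.
have A1 : A <= 1 by lra.
have c1 : - 1 <= c by have := cb 1; lra.
have c2 : c <= 1 by have := cb (-1); lra.
have Nge : (1 : R) <= n.+1%:R by rewrite ler1n.
have hD := drift_bound a K s d (x ord_max) (y ord_max) (e ord_max) sg
  a0 a1 K0 s0 s8 d0 d1 xm ym ltac:(by rewrite /e rsd) sgE.
rewrite -hds in hD.
apply: (no_interior_max_scalar _ _ _ _ _ _ _ _ s0 s8 h0 hd1 Nge KE A0 A1 c1 c2 sgE hD).
rewrite -hV -hU.
have : \sum_i (sg ^+ 2 * U i - V i +
     ((- (4 * sg ^+ 2 * K ^+ 2) * (h^-1 - d^-1) ^+ 2 - 4 * K * sg ^+ 2 * h^-1 ^+ 2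
        + 4 * K * sg ^+ 2 * d^-1 ^+ 2) * x i ^+ 2
     + (- (32 * sg ^+ 2 * K ^+ 2) * (h^-1 - d^-1) * h^-1
        + 32 * K * sg * (1 - sg) * h^-1 ^+ 2) * (x i * e i)
     + (- (64 * sg ^+ 2 * K ^+ 2) - 64 * K * (1 - sg) ^+ 2 + 64 * K ^+ 2) * h^-1 ^+ 2 * e i ^+ 2
     + K * ((- (2 * sg ^+ 2) - 8 * (1 - sg) ^+ 2 / r) / h + 2 * sg ^+ 2 / d))) <= 0.
  apply: sumr_le0 => i _; have hs := hi i; rewrite -subr_le0 in hs; apply: (le_trans _ hs).
  by rewrite le_eqVlt; apply/orP; left; apply/eqP; rewrite /P /Q; ring.
rewrite !big_split /= -!mulr_sumr sumrN -/A -/c e1 sumr_const card_ord.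
rewrite -(mulr_natr _ n.+1).
have h2 : 0 <= h ^+ 2 by exact: sqr_ge0.
move=> /(ler_wpM2l h2); rewrite mulr0 => hs; apply: (le_trans _ hs).
rewrite le_eqVlt; apply/orP; left; apply/eqP.
rewrite rsd hds sgE; field.
by rewrite !gt_eqF //; lra.
Qed.

End interior.

(** * Euclidean geometry and the clipping map *)

Section geometry.
Context {R : realType} {n : nat}.
Implicit Types (x y z : 'rV[R]_n.+1).

Definition sqn x : R := \sum_i x 0 i ^+ 2.

Definition dist x y : R := Num.sqrt (sqn (x - y)).

Definition axis (i : 'I_n.+1) : 'rV[R]_n.+1 := delta_mx 0 i.

Lemma axisE i j (t : R) : (t *: axis i) 0 j = if j == i then t else 0.
Proof. by rewrite !mxE eqxx /=; case: eqP; rewrite ?mulr1 ?mulr0. Qed.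

Lemma sqn_ge0 x : 0 <= sqn x.
Proof. by apply: sumr_ge0 => i _; exact: sqr_ge0. Qed.

Lemma dist_ge0 x y : 0 <= dist x y. Proof. exact: sqrtr_ge0. Qed.

Lemma sqr_dist x y : dist x y ^+ 2 = sqn (x - y).
Proof. by rewrite sqr_sqrtr // sqn_ge0. Qed.

Lemma dist_eq0 x y : dist x y = 0 -> x = y.
Proof.
move=> /(congr1 (fun t => t ^+ 2)); rewrite sqr_dist expr0n /= => /eqP.
rewrite psumr_eq0 => [|i _]; last exact: sqr_ge0.
move=> /allP h; apply/rowP => i; apply/eqP.
have := h i (mem_index_enum i); rewrite sqrf_eq0 !mxE subr_eq0.
exact.
Qed.

Lemma sqr_coord_le x i : x 0 i ^+ 2 <= sqn x.
Proof.
rewrite /sqn (bigD1 i) //= lerDl; apply: sumr_ge0 => j _; exact: sqr_ge0.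
Qed.

Lemma sqn_line x i t : sqn (x + t *: axis i) = sqn x + 2 * x 0 i * t + t ^+ 2.
Proof.
rewrite /sqn (bigD1 i) //= [in RHS](bigD1 i) //= mxE axisE eqxx.
rewrite (eq_bigr (fun j => x 0 j ^+ 2)); last first.
  by move=> j /negbTE ji; rewrite mxE axisE ji addr0.
by ring.
Qed.

(** A quadratic bound that is attained when the distance is r: near a maximum it
    replaces the distance, and the test functions become polynomials along
    lines. *)
Lemma dist_le_quad x y (r : R) : 0 < r -> dist x y <= (r + sqn (x - y) / r) / 2.
Proof.
move=> r0; rewrite -sqr_dist.
have -> : (r + dist x y ^+ 2 / r) / 2 = dist x y + (dist x y - r) ^+ 2 / (2 * r).
  by field; rewrite gt_eqF.
by rewrite lerDl divr_ge0 ?sqr_ge0 // mulr_ge0 // ltW.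
Qed.

Lemma continuous_sqn : continuous sqn.
Proof.
apply: continuous_big => [|i _ x]; first exact: add_continuous.
apply: (@continuous_comp _ _ _ (fun x : 'rV[R]_n.+1 => x 0 i) (fun t => t ^+ 2)).
  exact: coord_continuous.
exact: exprn_continuous.
Qed.

(** The projection onto the closed half space, written with max(t, 0) as
    t + (|t| - t) / 2. It turns continuity within the closed half space into
    continuity everywhere, where compactness arguments are simpler. *)
Definition clip x : 'rV[R]_n.+1 :=
  x + ((`|x 0 ord_max| - x 0 ord_max) / 2) *: axis ord_max.

Lemma clip_closed x : closed_half_space R n (clip x).
Proof.
rewrite /closed_half_space /= /clip mxE axisE eqxx.
have : 0 <= `|x 0 ord_max| + x 0 ord_max.
  by rewrite -lerBlDr sub0r -normrN ler_norm.
lra.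
Qed.

Lemma clip_id x : closed_half_space R n x -> clip x = x.
Proof.
by rewrite /closed_half_space /= => hx; rewrite /clip ger0_norm // subrr mul0r scale0r addr0.
Qed.

Lemma continuous_clip : continuous clip.
Proof.
move=> x.
have c : {for x, continuous (fun x : 'rV[R]_n.+1 => x 0 ord_max)}.
  exact: coord_continuous.
have cn : {for x, continuous (fun x : 'rV[R]_n.+1 => `|x 0 ord_max|)}.
  exact: (continuous_comp c (@norm_continuous _ R _)).
have cs : {for x, continuous (fun x : 'rV[R]_n.+1 =>
    (`|x 0 ord_max| - x 0 ord_max) * 2^-1)}.
  exact: (continuousM (continuousB cn c) (@cst_continuous _ _ _ _)).
have ci : {for x, continuous (@idfun 'rV[R]_n.+1)} by move=> A.
exact: (continuousD ci (continuousZr_tmp cs)).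
Qed.

Lemma within_comp (A B : set 'rV[R]_n.+1) (f : 'rV[R]_n.+1 -> 'rV[R]_n.+1)
    (u : 'rV[R]_n.+1 -> R) : continuous f -> (forall x, B x -> A (f x)) ->
  {within A, continuous u} -> {within B, continuous (u \o f)}.
Proof.
move=> cf BA /subspace_continuousP cu; apply/subspace_continuousP => x Bx.
have := cu _ (BA _ Bx); apply: cvg_comp => P.
rewrite /within /= => /(cf x); apply: (@filterS _ (nbhs x)) => y hy By.
exact: hy (BA _ By).
Qed.

Lemma continuous_clip_comp (u : 'rV[R]_n.+1 -> R) :
  {within closed_half_space R n, continuous u} -> continuous (u \o clip).
Proof.
move=> cu; apply/continuous_subspace_setT.
exact: (within_comp _ setT _ _ continuous_clip (fun x _ => clip_closed x) cu).
Qed.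

End geometry.

(** * Existence of a maximum of the doubled ratio *)

Section doubling.
Context {R : realType} {n : nat}.
Implicit Types (x y : 'rV[R]_n.+1) (u : 'rV[R]_n.+1 -> R).

Definition depth x : R := 1 - sqn x.

Definition gap x y : R := depth x - 8 * dist x y.

Lemma continuous_dist2 : continuous (fun z : 'rV[R]_n.+1 * 'rV[R]_n.+1 => dist z.1 z.2).
Proof.
move=> z; have c1 : {for z, continuous (@fst 'rV[R]_n.+1 'rV[R]_n.+1)} by exact: cvg_fst.
have c2 : {for z, continuous (@snd 'rV[R]_n.+1 'rV[R]_n.+1)} by exact: cvg_snd.
have cs := continuous_comp (continuousB c1 c2) (@continuous_sqn R n _).
exact: (continuous_comp cs (@sqrt_continuous R _)).
Qed.

Lemma continuous_depth : continuous depth.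
Proof.
move=> x; exact: (continuousB (@cst_continuous _ _ _ _) (@continuous_sqn R n x)).
Qed.

Lemma continuous_gap : continuous (fun z : 'rV[R]_n.+1 * 'rV[R]_n.+1 => gap z.1 z.2).
Proof.
move=> z; have c1 : {for z, continuous (@fst 'rV[R]_n.+1 'rV[R]_n.+1)} by exact: cvg_fst.
have cd := continuous_comp c1 (@continuous_depth z.1).
exact: (continuousB cd (continuousM (@cst_continuous _ _ _ _) (@continuous_dist2 z))).
Qed.

Lemma closed_preimage_ge0 {T : topologicalType} (f : T -> R) :
  continuous f -> closed [set z | 0 <= f z].
Proof.
move=> cf; rewrite (_ : [set z | 0 <= f z] = f @^-1` [set t | 0 <= t]) //.
by apply: (@preimage_closed T R) => [z _|]; [exact: cf|exact: (@closed_ge R 0)].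
Qed.

Lemma compact_box (b : R) : compact [set x : 'rV[R]_n.+1 | forall i, `|x 0 i| <= b].
Proof.
rewrite (_ : mkset _ = [set v : 'rV[R]_n.+1 | forall i, [set` `[- b, b]] (v ord0 i)]).
  have cs (i : 'I_n.+1) : compact [set` `[- b, b]] by exact: segment_compact.
  exact: (@rV_compact R n.+1 (fun=> [set` `[- b, b]]) cs).
by apply/seteqP; split => x /= hx i; have := hx i; rewrite in_itv /= ler_norml.
Qed.

Lemma gap_le_depth x y : gap x y <= depth x.
Proof. by rewrite /gap gerBl mulr_ge0 // dist_ge0. Qed.

Lemma depth_le1 x : depth x <= 1.
Proof. by rewrite /depth gerBl sqn_ge0. Qed.

Lemma gap_box x y : 0 <= gap x y ->
  (forall i, `|x 0 i| <= 2) /\ (forall i, `|y 0 i| <= 2).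
Proof.
move=> g0; have d0 := dist_ge0 x y.
have s0 := sqn_ge0 x; rewrite /gap /depth in g0.
have hx i : `|x 0 i| <= 1.
  rewrite -(@expr_le1 _ 2) // real_normK ?num_real //.
  by apply: le_trans (sqr_coord_le x i) _; lra.
have hxy i : `|x 0 i - y 0 i| <= 1.
  rewrite -(@expr_le1 _ 2) // real_normK ?num_real //.
  have := sqr_coord_le (x - y) i; rewrite !mxE => /le_trans; apply.
  by rewrite -sqr_dist expr_le1 //; lra.
split=> i; first by apply: le_trans (hx i) _; lra.
have -> : y 0 i = x 0 i - (x 0 i - y 0 i) by ring.
by apply: le_trans (ler_normB _ _) _; have := hx i; have := hxy i; lra.
Qed.

(** The ratio is discontinuous where d vanishes, so it is maximised over the
    compact set Z of the pairs with h >= 0 and c u2(y) <= u1(x). Off Z the ratio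
    is below c because h <= d; on Z the points differ, hence
    d >= 8 |x - y| > 0 and the ratio is continuous. *)
Lemma ratio_max_exists (K : nat) (c : R) u1 u2 x0 y0 : (0 < K)%N -> 0 < c ->
  {within closed_half_space R n, continuous u1} ->
  {within closed_half_space R n, continuous u2} ->
  (forall x, closed_half_space R n x -> sqn x <= 1 -> u1 x < c * u2 x) ->
  (forall y, closed_half_space R n y -> `|y 0 ord_max| <= 2 -> 0 < u2 y) ->
  closed_half_space R n x0 -> closed_half_space R n y0 -> 0 < gap x0 y0 ->
  c * (u2 y0 * depth x0 ^+ K) < u1 x0 * gap x0 y0 ^+ K ->
  exists x y M,
    [/\ closed_half_space R n x, closed_half_space R n y, 0 < dist x y,
        0 < gap x y & 0 < u2 y] /\
    [/\ 0 < M, u1 x * gap x y ^+ K = M * (u2 y * depth x ^+ K) &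
        forall x' y', closed_half_space R n x' -> closed_half_space R n y' ->
          0 < gap x' y' ->
          u1 x' * gap x' y' ^+ K <= M * (u2 y' * depth x' ^+ K)].
Proof.
move=> K0 c0 /continuous_clip_comp cu1 /continuous_clip_comp cu2 hdiag pos2 hx0 hy0 g0 h0.
pose T := ('rV[R]_n.+1 * 'rV[R]_n.+1)%type.
have cf (z : T) : {for z, continuous (@fst 'rV[R]_n.+1 'rV[R]_n.+1)} by exact: cvg_fst.
have cs (z : T) : {for z, continuous (@snd 'rV[R]_n.+1 'rV[R]_n.+1)} by exact: cvg_snd.
have cv1 (z : T) := continuous_comp (cf z) (cu1 z.1).
have cv2 (z : T) := continuous_comp (cs z) (cu2 z.2).
have cc : continuous (fun x : 'rV[R]_n.+1 => x 0 ord_max) by exact: coord_continuous.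
have cg1 (z : T) := continuous_comp (cf z) (cc z.1).
have cg2 (z : T) := continuous_comp (cs z) (cc z.2).
pose Z : set T := [set z : T | 0 <= z.1 0 ord_max] `&` [set z : T | 0 <= z.2 0 ord_max] `&`
  [set z : T | 0 <= gap z.1 z.2] `&` [set z : T | 0 <= u1 (clip z.1) - c * u2 (clip z.2)].
have cZ : compact Z.
  apply: (@subclosed_compact _ _ ([set x : 'rV[R]_n.+1 | forall i, `|x 0 i| <= 2] `*`
    [set x : 'rV[R]_n.+1 | forall i, `|x 0 i| <= 2])).
  - repeat apply: closedI; apply: closed_preimage_ge0 => z.
    + exact: cg1.
    + exact: cg2.
    + exact: continuous_gap.
    + exact: (continuousB (cv1 z) (continuousM (@cst_continuous _ _ _ _) (cv2 z))).
  - by apply: compact_setX; exact: compact_box.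
  - by move=> [x y] [[[_ _] /gap_box h] _].
(* on Z the two points differ, as u1 is smaller than c u2 on the diagonal *)
have Zpos x y : Z (x, y) -> [/\ 0 < dist x y, 0 < depth x & 0 < u2 y].
  move=> [[[/= hx hy] hg]]; rewrite !clip_id // => hu.
  have [_ hb] := gap_box x y hg.
  have y0' := pos2 y hy (hb ord_max).
  have r0 : 0 < dist x y.
    rewrite lt0r dist_ge0 andbT; apply/eqP => /dist_eq0 xy; subst y.
    have : sqn x <= 1 by have := le_trans hg (gap_le_depth _ _); rewrite /depth; lra.
    by move=> /(hdiag x hx); lra.
  split=> //.
  by apply: (@lt_le_trans _ _ (8 * dist x y)); [exact: mulr_gt0|move: hg; rewrite /gap; lra].
pose F (z : T) := u1 (clip z.1) * gap z.1 z.2 ^+ K * (u2 (clip z.2) * depth z.1 ^+ K)^-1.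
have cF : {within Z, continuous F}.
  apply: continuous_in_subspaceT => -[x y] /[!inE] Zxy.
  have [r0 d0 p0] := Zpos x y Zxy.
  have cG := continuous_comp (@continuous_gap (x, y)) (@exprn_continuous R K _).
  have cD := continuous_comp (continuous_comp (cf (x, y)) (@continuous_depth x))
    (@exprn_continuous R K _).
  have cden := continuousM (cv2 (x, y)) cD.
  apply: (continuousM (continuousM (cv1 (x, y)) cG)).
  apply: (continuousV _ cden) => /=.
  have [[[_ /= hy] _] _] := Zxy.
  by rewrite clip_id // gt_eqF // mulr_gt0 // exprn_gt0.
have den0 x y : closed_half_space R n y -> 0 < gap x y -> 0 < u2 y * depth x ^+ K.
  move=> hy hg; have [_ hb] := gap_box x y (ltW hg).
  by rewrite mulr_gt0 ?pos2 // exprn_gt0 // (lt_le_trans hg) // gap_le_depth.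
have gd x y : 0 < gap x y -> gap x y ^+ K <= depth x ^+ K.
  by move=> hg; rewrite lerXn2r ?nnegrE ?gap_le_depth // ltW // (lt_le_trans hg) // gap_le_depth.
have notZ x y : closed_half_space R n x -> closed_half_space R n y -> 0 < gap x y ->
    ~ Z (x, y) -> u1 x * gap x y ^+ K <= c * (u2 y * depth x ^+ K).
  move=> hx hy hg nZ; have u12 : u1 x < c * u2 y.
    rewrite ltNge; apply/negP => h; apply: nZ; split; first by split => //; exact: ltW.
    by rewrite /= !clip_id // subr_ge0.
  apply: (@le_trans _ _ (c * u2 y * gap x y ^+ K)).
    by apply: ler_wpM2r; rewrite ?exprn_ge0 // ltW.
  have [_ hb] := gap_box x y (ltW hg).
  rewrite -mulrA; apply: (ler_wpM2l (ltW c0)).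
  exact: (ler_wpM2l (ltW (pos2 y hy (hb ord_max))) (gd _ _ hg)).
have Z0 : Z (x0, y0).
  apply: contrapT => /(notZ _ _ hx0 hy0 g0); rewrite leNgt h0 //.
have [|[x y] Zxy Fmax] := compact_EVT_max _ cZ cF; first by exists (x0, y0).
rewrite inE in Zxy.
have Fmax' x' y' : Z (x', y') -> F (x', y') <= F (x, y).
  by move=> h; apply: Fmax; rewrite inE.
have [r0 d0 p0] := Zpos x y Zxy.
have [[[/= hx hy] hg] _] := Zxy.
have FE x' y' : closed_half_space R n x' -> closed_half_space R n y' ->
   F (x', y') = u1 x' * gap x' y' ^+ K / (u2 y' * depth x' ^+ K).
  by move=> a b; rewrite /F /= !clip_id.
have McF : c < F (x, y).
  apply: (lt_le_trans _ (Fmax' _ _ Z0)).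
  by rewrite FE // ltr_pdivlMr // den0.
have hg' : 0 < gap x y.
  rewrite lt0r hg andbT; apply/eqP => gE; move: McF.
  by rewrite FE // gE expr0n gtn_eqF //= mulr0 mul0r ltNge (ltW c0).
exists x, y, (F (x, y)); split; [by split|split].
- exact: lt_trans McF.
- by rewrite FE // mulfVK // gt_eqF // den0.
- move=> x' y' hx' hy' hg''; have [Zx|nZ] := pselect (Z (x', y')).
    by rewrite -ler_pdivrMr ?den0 // -FE // Fmax'.
  apply: le_trans (notZ _ _ hx' hy' hg'' nZ) _.
  exact: (ler_wpM2r (ltW (den0 _ _ hy' hg'')) (ltW McF)).
Qed.

End doubling.

(** * Properties of a maximum point *)

Lemma bernoulli_le {R : realDomainType} (K : nat) (z : R) : z <= 1 ->
  1 - K%:R * z <= (1 - z) ^+ K.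
Proof.
move=> z1; elim: K => [|K IH]; first by rewrite mul0r subr0 expr0.
have z0 : 0 <= 1 - z by rewrite subr_ge0.
rewrite exprS; apply: le_trans (ler_wpM2l z0 IH).
rewrite -natr1 -subr_ge0 (_ : _ - _ = K%:R * z ^+ 2); last by ring.
by rewrite mulr_ge0 // sqr_ge0.
Qed.

Section maximum_point.
Context {R : realType} {n : nat}.
Variables (K : nat) (M : R) (u1 u2 : 'rV[R]_n.+1 -> R) (x y : 'rV[R]_n.+1).
Hypothesis M0 : 0 < M.
Hypothesis hx : closed_half_space R n x.
Hypothesis hy : closed_half_space R n y.
Hypothesis r0 : 0 < dist x y.
Hypothesis g0 : 0 < gap x y.
Hypothesis p2 : 0 < u2 y.
Hypothesis nonneg1 : forall z, closed_half_space R n z -> 0 <= u1 z.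
Hypothesis heq : u1 x * gap x y ^+ K = M * (u2 y * depth x ^+ K).
Hypothesis hmax : forall x' y', closed_half_space R n x' ->
  closed_half_space R n y' -> 0 < gap x' y' ->
  u1 x' * gap x' y' ^+ K <= M * (u2 y' * depth x' ^+ K).

Let d0 : 0 < depth x. Proof. exact: lt_le_trans g0 (gap_le_depth _ _). Qed.

Lemma max_pos1 : 0 < u1 x.
Proof.
have : 0 < u1 x * gap x y ^+ K by rewrite heq !mulr_gt0 // exprn_gt0.
by rewrite pmulr_lgt0 // exprn_gt0.
Qed.

(** The bound of [dist_le_quad] with r the distance of the initial points. Both
    sides agree for s = t = 0, so at a maximum the left-hand side can be tested
    in place of the gap. *)
Lemma gap_along_line i (s t : R) :
  gap x y + (- (2 * x 0 i) * s - 8 * (s - t) * ((x 0 i - y 0 i) / dist x y))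
    - (s ^+ 2 + 4 * (s - t) ^+ 2 / dist x y)
  <= gap (x + s *: axis i) (y + t *: axis i).
Proof.
have := dist_le_quad (x + s *: axis i) (y + t *: axis i) _ r0.
rewrite (_ : x + s *: axis i - (y + t *: axis i) = (x - y) + (s - t) *: axis i); last first.
  by rewrite scalerBl opprD addrACA.
rewrite sqn_line -sqr_dist !mxE => hd.
rewrite /gap /depth sqn_line.
apply: le_trans (lerB (lexx _) (ler_wpM2l _ hd)); last by [].
rewrite le_eqVlt; apply/orP; left; apply/eqP; field.
by rewrite gt_eqF.
Qed.

(** The two points move along the same axis with speeds al and be. The speeds (1, 0) and (0, 1) yield the logarithmic gradients and the
    speeds (sg, 1) the second-order inequality of [no_interior_max]. *)
Lemma max_along_line i (p1 q1 s2 q2 al be : R) :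
  0 < x 0 ord_max -> 0 < y 0 ord_max ->
  jet2 (fun t => u1 (x + t *: axis i)) p1 q1 ->
  jet2 (fun t => u2 (y + t *: axis i)) s2 q2 ->
  al * p1 / u1 x + K%:R * ((- (2 * al * x 0 i)
      - 8 * (al - be) * ((x 0 i - y 0 i) / dist x y)) / gap x y)
    = be * s2 / u2 y + K%:R * (- (2 * al * x 0 i) / depth x) /\
  al ^+ 2 * q1 / u1 x - (al * p1 / u1 x) ^+ 2 +
    K%:R * ((2 * (- al ^+ 2 - 4 * (al - be) ^+ 2 / dist x y)) / gap x y
     - ((- (2 * al * x 0 i) - 8 * (al - be) * ((x 0 i - y 0 i) / dist x y)) / gap x y) ^+ 2)
  <= be ^+ 2 * q2 / u2 y - (be * s2 / u2 y) ^+ 2 +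
    K%:R * (2 * (- al ^+ 2) / depth x - (- (2 * al * x 0 i) / depth x) ^+ 2).
Proof.
move=> xm ym j1 j2.
have := jet2_quad (gap x y) (- (2 * al * x 0 i) - 8 * (al - be) * ((x 0 i - y 0 i) / dist x y))
  (- al ^+ 2 - 4 * (al - be) ^+ 2 / dist x y).
set H := fun t : R => _ => jH.
have := jet2_quad (depth x) (- (2 * al * x 0 i)) (- al ^+ 2).
set D := fun t : R => _ => jD.
have H0 : H 0 = gap x y by rewrite /H; ring.
have D0 : D 0 = depth x by rewrite /D; ring.
pose g1 t := u1 (x + (al * t) *: axis i).
pose g2 t := u2 (y + (be * t) *: axis i).
have g10 : g1 0 = u1 x by rewrite /g1 mulr0 scale0r addr0.
have g20 : g2 0 = u2 y by rewrite /g2 mulr0 scale0r addr0.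
have := @log_ratio_jets _ K M g1 g2 H D _ _ _ _ _ _ _ _
  (jet2_scale al _ _ _ j1) (jet2_scale be _ _ _ j2) jH jD.
rewrite g10 g20 H0 D0; apply => //; first exact: max_pos1.
have near_closed (z : 'rV[R]_n.+1) (k : R) : 0 < z 0 ord_max ->
    \forall t \near (0 : R), closed_half_space R n (z + (k * t) *: axis i).
  move=> zm; have jz := jet2_quad (z 0 ord_max) (if ord_max == i then k else 0) 0.
  have z0 : 0 < z 0 ord_max + (if ord_max == i then k else 0) * 0 + 0 * 0 ^+ 2.
    by rewrite mulr0 mul0r !addr0.
  have := jet2_continuous _ _ _ jz _ (lt_nbhsr z0); apply: (@filterS _ (nbhs (0 : R))) => t /=.
  rewrite /closed_half_space /= mxE axisE mul0r addr0; case: ifP => _ /ltW //.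
  by rewrite mul0r.
have H0' : 0 < H 0 by rewrite H0.
near=> t.
have Ht : 0 < H t by near: t; exact: (jet2_continuous _ _ _ jH _ (lt_nbhsr H0')).
have cx : closed_half_space R n (x + (al * t) *: axis i) by near: t; exact: near_closed.
have cy : closed_half_space R n (y + (be * t) *: axis i) by near: t; exact: near_closed.
have DE : D t = depth (x + (al * t) *: axis i) by rewrite /depth sqn_line /D /depth; ring.
have HE : H t <= gap (x + (al * t) *: axis i) (y + (be * t) *: axis i).
  apply: le_trans (gap_along_line i (al * t) (be * t)).
  by rewrite le_eqVlt; apply/orP; left; apply/eqP; rewrite /H; ring.
rewrite DE; apply: le_trans (hmax _ _ cx cy (lt_le_trans Ht HE)).
apply: ler_wpM2l; first exact: nonneg1.
by rewrite lerXn2r // nnegrE ltW // (lt_le_trans Ht).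
Unshelve. all: by end_near. Qed.

(** Moving one point off the boundary costs the gap only O(t^2): the first-order
    variation of the distance has the favourable sign, as the other point lies in
    the half space. *)
Lemma gap_boundary (s t : R) : 0 <= s -> 0 <= t ->
  (x 0 ord_max = 0 /\ t = 0) \/ (y 0 ord_max = 0 /\ s = 0) ->
  gap x y - (1 + 4 / dist x y) * (s + t) ^+ 2 <=
  gap (x + s *: axis ord_max) (y + t *: axis ord_max).
Proof.
move=> s0 t0 hb; apply: le_trans (gap_along_line ord_max s t).
have xm : 0 <= x 0 ord_max by [].
have ym : 0 <= y 0 ord_max by [].
case: hb => -[-> ->].
  rewrite -subr_ge0 (_ : _ - _ = 8 * s * y 0 ord_max / dist x y); last first.
    by field; rewrite gt_eqF.
  by rewrite divr_ge0 ?(ltW r0) // !mulr_ge0.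
rewrite -subr_ge0 (_ : _ - _ = 8 * t * x 0 ord_max / dist x y + t ^+ 2); last first.
  by field; rewrite gt_eqF.
by rewrite addr_ge0 ?sqr_ge0 // divr_ge0 ?(ltW r0) // !mulr_ge0.
Qed.


Let gap_small c : 0 <= c -> \forall t \near (0 : R)^'+,
  [/\ 0 < t, c * t ^+ 2 < 1 & K%:R * c * t * (u1 x + u2 y + t) < 1].
Proof.
move=> c0; have [C CE] : exists C, C = c + K%:R * c * (u1 x + u2 y + 1) + 1 by eexists.
have u0 : 0 < u1 x + u2 y by rewrite addr_gt0 // max_pos1.
have Kc : 0 <= K%:R * c by rewrite mulr_ge0.
have C1 : 0 <= K%:R * c * (u1 x + u2 y + 1) by rewrite mulr_ge0 // addr_ge0 // ltW.
have C0 : 0 < C by rewrite CE; lra.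
have CV : 0 < C^-1 by rewrite invr_gt0.
near=> t.
have t0 : 0 < t by near: t; exact: nbhs_right_gt.
have t1 : t < 1 by near: t; exact: nbhs_right_lt.
have tC : t * C < 1.
  by rewrite -ltr_pdivlMr // mul1r; near: t; exact: nbhs_right_lt.
split=> //.
- apply: le_lt_trans tC; rewrite expr2 mulrA mulrC ler_wpM2l ?(ltW t0) //.
  have : c * t <= c by rewrite ler_piMr // ltW.
  by rewrite CE; lra.
- apply: le_lt_trans tC; rewrite mulrAC mulrC ler_wpM2l ?(ltW t0) //.
  apply: (@le_trans _ _ (K%:R * c * (u1 x + u2 y + 1))).
    by apply: ler_wpM2l => //; rewrite lerD2l ltW.
  by rewrite CE; lra.
Unshelve. all: by end_near. Qed.

Let B := (1 + 4 / dist x y) / gap x y.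

Let B0 : 0 <= B.
Proof. by rewrite divr_ge0 ?(ltW g0) // addr_ge0 // divr_ge0 // ltW. Qed.

Let gap_pow (gt t : R) : gap x y - (1 + 4 / dist x y) * t ^+ 2 <= gt -> B * t ^+ 2 < 1 ->
  0 < gt /\ gap x y ^+ K * (1 - K%:R * (B * t ^+ 2)) <= gt ^+ K.
Proof.
rewrite (_ : gap x y - _ = gap x y * (1 - B * t ^+ 2)); last first.
  by rewrite /B; field; rewrite !gt_eqF.
move=> h b1.
have g1 : 0 < gap x y * (1 - B * t ^+ 2) by rewrite mulr_gt0 // subr_gt0.
split; first exact: lt_le_trans h.
apply: (@le_trans _ _ ((gap x y * (1 - B * t ^+ 2)) ^+ K)); last first.
  by rewrite lerXn2r // nnegrE ltW // (lt_le_trans g1).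
rewrite exprMn ler_wpM2l ?exprn_ge0 ?(ltW g0) //.
by rewrite bernoulli_le // ltW.
Qed.

(** A gain of order t in u1 cannot be compensated by the loss of order t^2 in the
    gap, while d decreases. *)
Lemma max_off_boundary1 :
  (\forall t \near (0 : R)^'+, u1 x + t <= u1 (x + t *: axis ord_max)) ->
  0 < x 0 ord_max.
Proof.
move=> steep; have xm : 0 <= x 0 ord_max by [].
rewrite lt0r xm andbT; apply/eqP => x0.
have [t [[t0 Bt Kt] st]] : exists t, [/\ 0 < t, B * t ^+ 2 < 1 &
    K%:R * B * t * (u1 x + u2 y + t) < 1] /\ u1 x + t <= u1 (x + t *: axis ord_max).
  by apply: (@filter_ex _ ((0 : R)^'+)); apply: filterI steep; exact: gap_small.
have := gap_boundary t 0 (ltW t0) (lexx _) (or_introl (conj x0 erefl)).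
rewrite addr0 scale0r addr0 => /gap_pow/(_ Bt)[gt0 hgt].
have cx : closed_half_space R n (x + t *: axis ord_max).
  by rewrite /closed_half_space /= mxE axisE eqxx x0 add0r ltW.
have := hmax _ _ cx hy gt0; apply/negP; rewrite -ltNge.
have dle : depth (x + t *: axis ord_max) ^+ K <= depth x ^+ K.
  have dE : depth (x + t *: axis ord_max) <= depth x.
    by rewrite /depth sqn_line x0 mulr0 mul0r addr0 lerB // lerDl sqr_ge0.
  rewrite lerXn2r // nnegrE ltW //.
  exact: lt_le_trans gt0 (gap_le_depth _ _).
apply: (@le_lt_trans _ _ (M * (u2 y * depth x ^+ K))).
  exact: (ler_wpM2l (ltW M0) (ler_wpM2l (ltW p2) dle)).
rewrite -heq; have u10 := max_pos1.
have gK : 0 < gap x y ^+ K by exact: exprn_gt0.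
apply: (@lt_le_trans _ _ ((u1 x + t) * (gap x y ^+ K * (1 - K%:R * (B * t ^+ 2))))).
  rewrite mulrCA [ltLHS]mulrC ltr_pM2l //.
  have : t * (K%:R * B * t * (u1 x + t)) < t * 1.
    rewrite ltr_pM2l //; apply: le_lt_trans Kt.
    have KB : 0 <= K%:R * B * t by apply: mulr_ge0 (ltW t0); exact: mulr_ge0.
    by apply: ler_wpM2l => //; have := p2; lra.
  have -> : (u1 x + t) * (1 - K%:R * (B * t ^+ 2)) =
    u1 x + t - t * (K%:R * B * t * (u1 x + t)) by ring.
  lra.
apply: (@le_trans _ _ ((u1 x + t) * gap (x + t *: axis ord_max) y ^+ K)).
  by apply: ler_wpM2l => //; rewrite addr_ge0 // ltW.
by apply: ler_wpM2r => //; rewrite exprn_ge0 // ltW.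
Qed.

Lemma max_off_boundary2 :
  (\forall t \near (0 : R)^'+, u2 (y + t *: axis ord_max) <= u2 y - t) ->
  0 < y 0 ord_max.
Proof.
move=> steep; have ym : 0 <= y 0 ord_max by [].
rewrite lt0r ym andbT; apply/eqP => y0.
have [t [[t0 Bt Kt] st]] : exists t, [/\ 0 < t, B * t ^+ 2 < 1 &
    K%:R * B * t * (u1 x + u2 y + t) < 1] /\ u2 (y + t *: axis ord_max) <= u2 y - t.
  by apply: (@filter_ex _ ((0 : R)^'+)); apply: filterI steep; exact: gap_small.
have := gap_boundary 0 t (lexx _) (ltW t0) (or_intror (conj y0 erefl)).
rewrite add0r scale0r addr0 => /gap_pow/(_ Bt)[gt0 hgt].
have cy : closed_half_space R n (y + t *: axis ord_max).
  by rewrite /closed_half_space /= mxE axisE eqxx y0 add0r ltW.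
have := hmax _ _ hx cy gt0; apply/negP; rewrite -ltNge.
have u10 := max_pos1; have dK : 0 < depth x ^+ K by exact: exprn_gt0.
apply: (@le_lt_trans _ _ (M * ((u2 y - t) * depth x ^+ K))).
  exact: (ler_wpM2l (ltW M0) (ler_wpM2r (ltW dK) st)).
apply: (@lt_le_trans _ _ (u1 x * (gap x y ^+ K * (1 - K%:R * (B * t ^+ 2))))); last first.
  exact: (ler_wpM2l (ltW u10) hgt).
rewrite [u1 x * _]mulrA heq (_ : M * (u2 y * _) * _ =
  M * (u2 y * (1 - K%:R * (B * t ^+ 2)) * depth x ^+ K)); last by ring.
rewrite ltr_pM2l // ltr_pM2r //.
have : t * (K%:R * B * t * u2 y) < t * 1.
  rewrite ltr_pM2l //; apply: le_lt_trans Kt.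
  have KB : 0 <= K%:R * B * t by apply: mulr_ge0 (ltW t0); exact: mulr_ge0.
  by apply: ler_wpM2l => //; lra.
have -> : u2 y * (1 - K%:R * (B * t ^+ 2)) = u2 y - t * (K%:R * B * t * u2 y) by ring.
lra.
Qed.

End maximum_point.

(** * The comparison of two solutions *)

Section harnack.
Context {R : realType} {n : nat}.
Implicit Types (x y : 'rV[R]_n.+1) (u w : 'rV[R]_n.+1 -> R).

(** Solutions of x_N Delta u + a d_N u = 0, that is of div (x_N^a grad u) = 0
    expanded and divided by x_N^(a - 1). *)
Definition wharmonic (a : R) u := forall x, half_space R n x ->
  exists p q : 'I_n.+1 -> R,
    (forall i, jet2 (fun t => u (x + t *: axis i)) (p i) (q i)) /\
    x 0 ord_max * \sum_i q i + a * p ord_max = 0.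

(** The slope hypotheses at the boundary play the part of a boundary condition;
    the diagonal hypothesis is what makes the two points of a maximum distinct. *)
Lemma doubling_ineq (a c : R) u1 u2 : 0 < a -> a <= 1 -> 0 < c ->
  wharmonic a u1 -> wharmonic a u2 ->
  {within closed_half_space R n, continuous u1} ->
  {within closed_half_space R n, continuous u2} ->
  (forall x, closed_half_space R n x -> 0 <= u1 x) ->
  (forall x, closed_half_space R n x -> sqn x <= 1 -> u1 x < c * u2 x) ->
  (forall y, closed_half_space R n y -> `|y 0 ord_max| <= 2 -> 0 < u2 y) ->
  (forall x, x 0 ord_max = 0 ->
     \forall t \near (0 : R)^'+, u1 x + t <= u1 (x + t *: axis ord_max)) ->
  (forall y, y 0 ord_max = 0 ->
     \forall t \near (0 : R)^'+, u2 (y + t *: axis ord_max) <= u2 y - t) ->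
  forall x y, closed_half_space R n x -> closed_half_space R n y -> 0 < gap x y ->
  u1 x * gap x y ^+ (5 * n.+1) <= c * (u2 y * depth x ^+ (5 * n.+1)).
Proof.
move=> a0 a1 c0 w1 w2 cu1 cu2 nonneg1 hdiag pos2 steep1 steep2 x0 y0 hx0 hy0 g00.
rewrite leNgt; apply/negP => hlt.
have [x [y [M [[hx hy r0 g0 p2] [M0 heq hmax]]]]] :=
  ratio_max_exists (5 * n.+1) c u1 u2 x0 y0 isT c0 cu1 cu2 hdiag pos2 hx0 hy0 g00 hlt.
have p1 := max_pos1 _ _ _ _ _ _ M0 g0 p2 heq.
have xm : 0 < x 0 ord_max.
  have [e|ne] := eqVneq (x 0 ord_max) 0; last by rewrite lt0r ne.
  exact: (max_off_boundary1 _ _ _ _ _ _ M0 hx hy r0 g0 p2 heq hmax (steep1 x e)).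
have ym : 0 < y 0 ord_max.
  have [e|ne] := eqVneq (y 0 ord_max) 0; last by rewrite lt0r ne.
  exact: (max_off_boundary2 _ _ _ _ _ _ M0 hx hy r0 g0 p2 heq hmax (steep2 y e)).
have [p [q [jp eqp]]] := w1 x xm.
have [s [z [js eqs]]] := w2 y ym.
pose K : R := (5 * n.+1)%:R.
have line i al be := max_along_line _ _ _ _ _ _ M0 r0 g0 p2 nonneg1 heq hmax
  i (p i) (q i) (s i) (z i) al be xm ym (jp i) (js i).
pose e i := (x 0 i - y 0 i) / dist x y.
have PE i : p i / u1 x =
    K * (- (2 * x 0 i) / depth x) - K * ((- (2 * x 0 i) - 8 * e i) / gap x y).
  have [h _] := line i 1 0.
  have -> : p i / u1 x = (1 * p i / u1 x + K * ((- (2 * 1 * x 0 i)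
      - 8 * (1 - 0) * ((x 0 i - y 0 i) / dist x y)) / gap x y))
      - K * ((- (2 * x 0 i) - 8 * e i) / gap x y).
    by rewrite /e; ring.
  by rewrite h; ring.
have QE i : s i / u2 y = K * (8 * e i / gap x y).
  have [h _] := line i 0 1.
  have -> : s i / u2 y = (1 * s i / u2 y + K * (- (2 * 0 * x 0 i) / depth x)) by ring.
  by rewrite -h /e; ring.
pose sg := 1 - 4 * (dist x y / depth x).
apply: (no_interior_max n a (dist x y) (depth x) (gap x y) K sg
  (fun i => x 0 i) (fun i => y 0 i) (fun i => q i / u1 x) (fun i => z i / u2 y)) => //.
- by rewrite sqr_dist /sqn; apply: eq_bigr => i _; rewrite !mxE.
- by rewrite /K natrM.
- rewrite -PE -mulr_suml; apply: (mulfI (lt0r_neq0 xm)).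
  rewrite mulrA (_ : _ * (\sum_i q i) = - (a * p ord_max)); last first.
    by apply/eqP; rewrite -addr_eq0 eqp.
  by field; rewrite !gt_eqF.
- rewrite -QE -mulr_suml; apply: (mulfI (lt0r_neq0 ym)).
  rewrite mulrA (_ : _ * (\sum_i z i) = - (a * s ord_max)); last first.
    by apply/eqP; rewrite -addr_eq0 eqs.
  by field; rewrite !gt_eqF.
move=> i; have [_ h] := line i sg 1.
rewrite -PE -QE; set lhs := (X in X <= _); set rhs := (X in _ <= X).
have <- : sg ^+ 2 * q i / u1 x - (sg * p i / u1 x) ^+ 2 +
    K * ((2 * (- sg ^+ 2 - 4 * (sg - 1) ^+ 2 / dist x y)) / gap x y
     - ((- (2 * sg * x 0 i) - 8 * (sg - 1) * ((x 0 i - y 0 i) / dist x y)) / gap x y) ^+ 2) = lhs.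
  by rewrite /lhs; ring.
have <- : 1 ^+ 2 * z i / u2 y - (1 * s i / u2 y) ^+ 2 +
    K * (2 * (- sg ^+ 2) / depth x - (- (2 * sg * x 0 i) / depth x) ^+ 2) = rhs.
  by rewrite /rhs; ring.
exact: h.
Qed.

Lemma wharmonic_comb a u w (k c : R) : wharmonic a u -> wharmonic a w ->
  wharmonic a (fun x => u x + c + k * w x).
Proof.
move=> hu hw x hx; have [p [q [jp ep]]] := hu x hx; have [s [z [js es]]] := hw x hx.
exists (fun i => p i + 0 + k * s i), (fun i => q i + 0 + k * z i); split.
  move=> i; have jc := jet2D _ _ _ _ _ _ (jp i) (jet2_cst c).
  exact: (jet2D _ _ _ _ _ _ jc (jet2Z k _ _ _ (js i))).
under eq_bigr do rewrite addr0.
rewrite big_split /= -mulr_sumr addr0.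
rewrite (_ : _ + _ = (x 0 ord_max * (\sum_i q i) + a * p ord_max) +
  k * (x 0 ord_max * (\sum_i z i) + a * s ord_max)); last by ring.
by rewrite ep es mulr0 addr0.
Qed.

(** The second solution of the equation in the last variable alone; its derivative
    (1 - a) x_N^(- a) is infinite on the boundary. *)
Lemma wharmonic_powR a : wharmonic a (fun x => x 0 ord_max `^ (1 - a)).
Proof.
move=> x hx; set b := 1 - a; set xm := x 0 ord_max.
exists (fun i => if ord_max == i then b * xm `^ (b - 1) else 0),
  (fun i => if ord_max == i then b * ((b - 1) * xm `^ (b - 1 - 1)) else 0); split.
  move=> i; rewrite (_ : (fun t => _) =
    (fun t => (xm + (if ord_max == i then t else 0)) `^ b)); last first.
    by apply/funext => t; rewrite mxE axisE.
  by case: eqP => _; [exact: jet2_powR|exact: jet2_cst].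
rewrite eqxx (bigD1 ord_max) //= eqxx big1 ?addr0; last first.
  by move=> i; rewrite eq_sym => /negbTE ->.
have -> : xm `^ (b - 1) = xm * xm `^ (b - 1 - 1).
  rewrite -[X in _ = X * _](powRr1 (ltW hx)) -powRD; last first.
    by apply/implyP => _; rewrite gt_eqF.
  by congr (_ `^ _); ring.
by rewrite /b; ring.
Qed.

Lemma continuous_powR_last (b : R) : 0 < b ->
  {within closed_half_space R n, continuous (fun x : 'rV[R]_n.+1 => x 0 ord_max `^ b)}.
Proof.
move=> b0; apply/subspace_continuousP => x hx.
have cc : {for x, continuous (fun x : 'rV[R]_n.+1 => x 0 ord_max)} by exact: coord_continuous.
have [x0|nx] := eqVneq (x 0 ord_max) 0; last first.
  have xp : 0 < x 0 ord_max by rewrite lt0r nx.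
  have cp : {for x 0 ord_max, continuous (fun t : R => t `^ b)}.
    apply/differentiable_continuous/derivable1_diffP.
    by have [] := @is_derive1_powR R b _ xp.
  move=> P hP; have := continuous_comp cc cp hP.
  by apply: (@filterS _ (nbhs x)) => z hz _; exact: hz.
rewrite /from_subspace /= x0 powR0 ?gt_eqF //; apply/(@cvgrPdist_lt R R) => e e0.
have d0 : 0 < e `^ b^-1 by rewrite powR_gt0.
 have : nbhs x [set z : 'rV[R]_n.+1 | z 0 ord_max < e `^ b^-1].
  by apply: (cc [set t | t < e `^ b^-1]); rewrite x0; exact: lt_nbhsl.
rewrite /within /=; apply: (@filterS _ (nbhs x)) => z hz zc.
rewrite sub0r normrN ger0_norm ?powR_ge0 //.
have -> : e = (e `^ b^-1) `^ b by rewrite -powRrM mulVf ?gt_eqF // powRr1 // ltW.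
by rewrite gt0_ltr_powR // nnegrE ?ltW.
Qed.

End harnack.

(** * The Harnack inequality and the Liouville property *)

Section liouville.
Context {R : realType} {n : nat}.
Implicit Types (x y : 'rV[R]_n.+1) (u : 'rV[R]_n.+1 -> R).

Definition boundary_lipschitz u := forall x, x 0 ord_max = 0 ->
  exists G d : R, 0 < d /\
    forall t, 0 < t -> t < d -> `|u (x + t *: axis ord_max) - u x| <= G * t.

(** [doubling_ineq] for u + e +- k x_N^(1 - a) and c = 1 + e, letting e tend to 0.
    With k = e^2 / 16 the two functions stay within the ratio 1 + e on the
    diagonal, where x_N <= 1, and the second one is positive for x_N <= 2. *)
Lemma harnack_unit a u : 0 < a -> a < 1 ->
  wharmonic a u -> {within closed_half_space R n, continuous u} ->
  (forall x, closed_half_space R n x -> 0 <= u x) -> boundary_lipschitz u ->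
  forall x y, closed_half_space R n x -> closed_half_space R n y -> 0 < gap x y ->
  u x * gap x y ^+ (5 * n.+1) <= u y.
Proof.
move=> a0 a1 hw cu nonneg lip x y hx hy g0.
have b0 : 0 < 1 - a by rewrite subr_gt0.
have dle : depth x ^+ (5 * n.+1) <= 1.
  by rewrite exprn_ile1 ?depth_le1 // ltW // (lt_le_trans g0) // gap_le_depth.
pose w z := (z : 'rV[R]_n.+1) 0 ord_max `^ (1 - a).
have w0 z : 0 <= w z by exact: powR_ge0.
have cw : {within closed_half_space R n, continuous w} by exact: continuous_powR_last.
(* e measures both the perturbation of u and the excess of c over 1 *)
have key (e : R) : 0 < e -> e <= 1 -> u x * gap x y ^+ (5 * n.+1) <= (1 + e) * (u y + e).
  move=> e0 e1; pose k := e ^+ 2 / 16.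
  have k0 : 0 < k by rewrite divr_gt0 // exprn_gt0.
  have ek : 8 * k <= e.
    have : e ^+ 2 <= e by rewrite expr2 ler_piMr // ltW.
    by rewrite /k; lra.
  have wle b z : 1 <= b -> closed_half_space R n z -> z 0 ord_max <= b -> w z <= b.
    move=> b1 hz zb; apply: le_trans (@ler1_powR _ b (1 - a) b1 _); last by rewrite gerBl ltW.
    by apply: ge0_ler_powR; rewrite ?nnegrE ?(ltW b0) // (le_trans _ b1).
  (* at a boundary point, k w grows faster than the variation of u plus t *)
  have comb (z : 'rV[R]_n.+1) : z 0 ord_max = 0 ->
      \forall t \near (0 : R)^'+, `|u (z + t *: axis ord_max) - u z| + t <=
         k * w (z + t *: axis ord_max) /\ w z = 0.
    move=> z0; have [G [d [d0 hG]]] := lip z z0; near=> t.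
    have t0 : 0 < t by near: t; exact: nbhs_right_gt.
    have td : t < d by near: t; exact: nbhs_right_lt.
    have st : (G + 1) * t <= k * t `^ (1 - a) by near: t; exact: powR_steep.
    split; last by rewrite /w z0 powR0 // gt_eqF.
    rewrite /w mxE axisE eqxx z0 add0r; apply: le_trans st.
    by rewrite mulrDl mul1r lerD2r hG.
  have cont (c' : R) : {within closed_half_space R n, continuous (fun z => u z + e + c' * w z)}.
    move=> z; have c1 := continuousM (@cst_continuous _ _ c' z) (cw z).
    exact: (continuousD (continuousD (cu z) (@cst_continuous _ _ e z)) c1).
  have := doubling_ineq a (1 + e) (fun z => u z + e + k * w z) (fun z => u z + e + (- k) * w z)
    a0 (ltW a1) _ (wharmonic_comb a _ _ k e hw (wharmonic_powR a))
    (wharmonic_comb a _ _ (- k) e hw (wharmonic_powR a)) (cont k) (cont (- k)).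
  move=> /(_ _ _ _ _ _ _ x y hx hy g0) H.
  apply: le_trans (le_trans (H _ _ _ _ _ _) _).
  - apply: ler_wpM2r; first by rewrite exprn_ge0 // ltW.
    by rewrite -addrA lerDl addr_ge0 ?(ltW e0) // mulr_ge0 // ltW.
  - lra.
  - by move=> z hz; rewrite !addr_ge0 ?(ltW e0) ?nonneg // mulr_ge0 // ltW.
  - move=> z hz z1.
    have wz : w z <= 1.
      apply: wle => //; apply: le_trans (ler_norm _) _.
      by rewrite -(@expr_le1 _ 2) // real_normK ?num_real // (le_trans (sqr_coord_le z _)).
    have kw : k * w z <= k by rewrite ler_piMr // ltW.
    have eu : 0 <= e * u z by rewrite mulr_ge0 ?nonneg // ltW.
    have ekw : e * (k * w z) <= k * w z.
      by rewrite ler_piMl // mulr_ge0 // ltW.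
    rewrite -subr_gt0 (_ : _ - _ = e ^+ 2 + e * u z - 2 * (k * w z) - e * (k * w z)); last by ring.
    have : e ^+ 2 = 16 * k by rewrite /k; field.
    lra.
  - move=> z hz /ler_normlW z2.
    have wz : w z <= 2 by apply: wle => //; lra.
    have := ler_wpM2l (ltW k0) wz; have := nonneg z hz; rewrite mulNr; lra.
  - move=> z z0; have := comb z z0; apply: (@filterS _ ((0 : R)^'+)) => t [h wz].
    rewrite wz mulr0 addr0; have := ler_norm (u z - u (z + t *: axis ord_max)).
    rewrite distrC; lra.
  - move=> z z0; have := comb z z0; apply: (@filterS _ ((0 : R)^'+)) => t [h wz].
    rewrite wz mulr0 addr0; have := ler_norm (u (z + t *: axis ord_max) - u z).
    rewrite mulNr; lra.
  - have e1' : 0 <= 1 + e by lra.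
    apply: ler_wpM2l => //.
    have uy : 0 <= u y + e by rewrite addr_ge0 ?nonneg // ltW.
    apply: (@le_trans _ _ ((u y + e) * depth x ^+ (5 * n.+1))).
      apply: ler_wpM2r; first by rewrite exprn_ge0 // ltW // (lt_le_trans g0) // gap_le_depth.
      by rewrite mulNr lerBlDr lerDl mulr_ge0 // ltW.
    by rewrite ler_piMr.
have uy := nonneg y hy.
rewrite leNgt; apply/negP; set X := u x * _ in key * => lt.
have q0 : 0 < 3 + u y by lra.
(* (1 + e) (u y + e) <= u y + e (3 + u y) < X for this e *)
pose e := Num.min 1 ((X - u y) / (3 + u y) / 2).
have d0 : 0 < (X - u y) / (3 + u y) / 2 by rewrite !divr_gt0 // subr_gt0.
have e0 : 0 < e by rewrite lt_min ltr01.
have e1 : e <= 1 by rewrite ge_min lexx.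
have e2 : e * (3 + u y) * 2 <= X - u y.
  by rewrite -ler_pdivlMr // -ler_pdivlMr // mulrAC ge_min lexx orbT.
have := key e e0 e1; have := ler_wpM2l (ltW e0) e1.
have -> : (1 + e) * (u y + e) = u y + e * (3 + u y) - 2 * e + e * e by ring.
have : 0 < e * (3 + u y) by exact: mulr_gt0.
rewrite mulr1; move: e2; rewrite mulr_natr mulr2n; lra.
Unshelve. all: by end_near. Qed.

Lemma sqnZ (k : R) x : sqn (k *: x) = k ^+ 2 * sqn x.
Proof. by rewrite /sqn mulr_sumr; apply: eq_bigr => i _; rewrite mxE exprMn. Qed.

Lemma distZ (k : R) x y : 0 <= k -> dist (k *: x) (k *: y) = k * dist x y.
Proof.
by move=> k0; rewrite /dist -scalerBr sqnZ sqrtrM ?sqr_ge0 // sqrtr_sqr ger0_norm.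
Qed.

Lemma wharmonicZ a u (k : R) : 0 < k -> wharmonic a u -> wharmonic a (fun x => u (k *: x)).
Proof.
move=> k0 hu x hx.
have [|p [q [jp ep]]] := hu (k *: x); first by rewrite /half_space /= mxE mulr_gt0.
exists (fun i => k * p i), (fun i => k ^+ 2 * q i); split.
  move=> i; have := jet2_scale k _ _ _ (jp i); congr jet2; apply/funext => t.
  by rewrite scalerDr scalerA.
rewrite -mulr_sumr (_ : _ + _ = k * ((k *: x) 0 ord_max * (\sum_i q i) + a * p ord_max)).
  by rewrite ep mulr0.
by rewrite mxE; ring.
Qed.

(** The equation is invariant under dilations. Contracting by k, the gap is at
    least 1 - k S with S independent of k, and Bernoulli gives
    u(x) (1 - K k S) <= u(y). *)
Lemma liouville_le a u : 0 < a -> a < 1 ->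
  wharmonic a u -> {within closed_half_space R n, continuous u} ->
  (forall x, closed_half_space R n x -> 0 <= u x) -> boundary_lipschitz u ->
  forall x y, closed_half_space R n x -> closed_half_space R n y -> u x <= u y.
Proof.
move=> a0 a1 hw cu nonneg lip x y hx hy.
rewrite leNgt; apply/negP => uxy; have ux := nonneg x hx; have uy := nonneg y hy.
pose S := sqn x + 8 * dist x y.
have S0 : 0 <= S by rewrite addr_ge0 ?sqn_ge0 // mulr_ge0 // dist_ge0.
pose K : R := (5 * n.+1)%:R.
have dxy : 0 < u x - u y by rewrite subr_gt0.
have [k [k0 [k1 [kS kK]]]] : exists k : R, 0 < k /\ k <= 1 /\ k * S < 1 /\
    k * (K * S * u x) < u x - u y.
  (* T = 1 / k is large enough for each of the three bounds *)
  pose T := S + K * S * u x / (u x - u y) + 1.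
  have T1 : 0 <= K * S * u x / (u x - u y).
    by rewrite divr_ge0 ?(ltW dxy) // mulr_ge0 // mulr_ge0.
  have T0 : 0 < T by rewrite /T; lra.
  exists T^-1; rewrite invr_gt0 T0; split=> //; split; last split.
  - by rewrite invf_le1 // /T; lra.
  - by rewrite mulrC ltr_pdivrMr // mul1r /T; lra.
  - by rewrite mulrC ltr_pdivrMr // [ltRHS]mulrC -ltr_pdivrMr // /T; lra.
have kV : 0 < k^-1 by rewrite invr_gt0.
pose v z := u (k^-1 *: z).
have vE z : v (k *: z) = u z by rewrite /v scalerA mulVf ?gt_eqF // scale1r.
have closedZ (l : R) z : 0 < l -> closed_half_space R n z -> closed_half_space R n (l *: z).
  by move=> l0 hz; rewrite /closed_half_space /= mxE mulr_ge0 // ltW.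
have gE : 1 - k * S <= gap (k *: x) (k *: y).
  rewrite /gap /depth sqnZ distZ ?(ltW k0) //.
  have : k ^+ 2 * sqn x <= k * sqn x.
    by rewrite ler_wpM2r ?sqn_ge0 // expr2 ler_piMr // ltW.
  rewrite /S; lra.
have g0 : 0 < gap (k *: x) (k *: y) by apply: lt_le_trans gE; rewrite subr_gt0.
have := @harnack_unit a v a0 a1 (wharmonicZ a u _ kV hw) _ _ _ (k *: x) (k *: y)
  (closedZ _ _ k0 hx) (closedZ _ _ k0 hy) g0.
rewrite !vE => H.
have : u x * gap (k *: x) (k *: y) ^+ (5 * n.+1) <= u y.
  apply: H.
  - apply: (within_comp (closed_half_space R n) (closed_half_space R n) (fun z => k^-1 *: z) u) => //.
      exact: scaler_continuous.
    by move=> z; exact: closedZ.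
  - by move=> z hz; apply: nonneg; exact: closedZ.
  - move=> z z0; have [|G [d [d0 hG]]] := lip (k^-1 *: z); first by rewrite mxE z0 mulr0.
    exists (G * k^-1), (k * d); split; first exact: mulr_gt0.
    move=> t t0 td; rewrite /v scalerDr scalerA -mulrA; apply: hG; first exact: mulr_gt0.
    by rewrite mulrC ltr_pdivrMr // mulrC.
apply/negP; rewrite -ltNge.
have p1 : 1 - K * (k * S) <= gap (k *: x) (k *: y) ^+ (5 * n.+1).
  apply: le_trans (bernoulli_le _ _ (ltW kS)) _.
  by rewrite lerXn2r // nnegrE ?ltW // subr_gt0.
apply: lt_le_trans (ler_wpM2l ux p1).
have -> : u x * (1 - K * (k * S)) = u x - k * (K * S * u x) by ring.
lra.
Qed.

End liouville.

(** * From the C^2 hypotheses to jets *)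

Section classical_solutions.
Context {R : realType} {n : nat}.
Implicit Types (x v : 'rV[R]_n.+1) (u F : 'rV[R]_n.+1 -> R).

(** A directional derivative is the derivative along a line: this transfers the
    one-variable rules in both directions. *)
Lemma is_derive_line F x v (t d : R) :
  is_derive t 1 (fun s => F (x + s *: v)) d <-> is_derive (x + t *: v) v F d.
Proof.
have E : (fun h : R => h^-1 *: (((fun s => F (x + s *: v)) \o shift t) (h *: 1) - F (x + t *: v))) =
    (fun h : R => h^-1 *: ((F \o shift (x + t *: v)) (h *: v) - F (x + t *: v))).
  apply/funext => h /=; congr (_ *: (F _ - _)).
  by rewrite [_%:A]mulr1 scalerDl addrCA.
split=> -[h1 h2]; constructor.
- by rewrite /derivable -E; exact: h1.
- by rewrite -h2 /derive -E.
- by move: h1; rewrite /derivable -E; exact.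
- by move: h2; rewrite /derive -E; exact.
Qed.

Lemma half_space_line x i : half_space R n x ->
  \forall t \near (0 : R), half_space R n (x + t *: axis i).
Proof.
move=> hx; have j := jet2_quad (x 0 ord_max) (if ord_max == i then 1 else 0) 0.
have z0 : 0 < x 0 ord_max + (if ord_max == i then 1 else 0) * 0 + 0 * 0 ^+ 2.
  by rewrite mulr0 mul0r !addr0.
have := jet2_continuous _ _ _ j _ (lt_nbhsr z0).
apply: (@filterS _ (nbhs (0 : R))) => t /=.
rewrite /half_space /= mxE axisE mul0r addr0; case: ifP => _ //.
- by rewrite mul1r.
- by rewrite mul0r.
Qed.

Lemma C2_wharmonic a u : Ck 2 (half_space R n) u ->
  (forall x, half_space R n x ->
    div (fun y => (y 0 ord_max `^ a) *: grad u y) x = 0) ->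
  wharmonic a u.
Proof.
move=> [_ hC] heq x hx.
have d1 i z : half_space R n z -> is_derive z (axis i) u (partial i u z).
  by move=> hz; apply: derivableP; apply: (hC i).1; rewrite inE.
have d2 i z : half_space R n z ->
    is_derive z (axis i) (partial i u) (partial i (partial i u) z).
  move=> hz; apply: derivableP; have [_ [_ h]] := hC i.
  by apply: (h i).1; rewrite inE.
exists (fun i => partial i u x), (fun i => partial i (partial i u) x); split.
  move=> i; exists (fun t => partial i u (x + t *: axis i)); split.
  - have := half_space_line x i hx; apply: (@filterS _ (nbhs (0 : R))) => t ht.
    by apply/is_derive_line; exact: d1.
  - by rewrite scale0r addr0.
  - apply/is_derive_line; rewrite scale0r addr0; exact: d2.
have xm : 0 < x 0 ord_max := hx.
have dw i : is_derive x (axis i) (fun y => y 0 ord_max `^ a)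
    (if ord_max == i then a * x 0 ord_max `^ (a - 1) else 0).
  suff : is_derive (0 : R) 1 (fun t => (x + t *: axis i) 0 ord_max `^ a)
      (if ord_max == i then a * x 0 ord_max `^ (a - 1) else 0).
    move=> /(is_derive_line (fun y => y 0 ord_max `^ a)).
    by rewrite scale0r addr0.
  rewrite (_ : (fun t => _) =
    (fun t => (x 0 ord_max + (if ord_max == i then t else 0)) `^ a)); last first.
    by apply/funext => t; rewrite mxE axisE.
  case: eqP => _; last exact: is_derive_cst.
  by have [g [/nbhs_singleton h <- _]] := jet2_powR a _ xm.
have := heq x hx; rewrite /div.
have E i : partial i (fun y => (y 0 ord_max `^ a *: grad u y) 0 i) x =
    x 0 ord_max `^ a * partial i (partial i u) x
    + partial i u x * (if ord_max == i then a * x 0 ord_max `^ (a - 1) else 0).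
  rewrite (_ : (fun y => _) = (fun y : 'rV[R]_n.+1 => y 0 ord_max `^ a) * partial i u); last first.
    by apply/funext => y; rewrite !mxE.
  by have [_ h] := is_deriveM (dw i) (d2 i x hx); exact: h.
rewrite (eq_bigr _ (fun i _ => E i)) big_split /= -mulr_sumr.
rewrite [X in _ + X](bigD1 ord_max) //= eqxx [X in _ + (_ + X)]big1 ?addr0; last first.
  by move=> i; rewrite eq_sym => /negbTE ->; rewrite mulr0.
have -> : x 0 ord_max `^ a = x 0 ord_max * x 0 ord_max `^ (a - 1).
  rewrite -[X in _ = X * _](powRr1 (ltW xm)) -powRD; last first.
    by apply/implyP => _; rewrite gt_eqF.
  by congr (_ `^ _); ring.
have w0 : x 0 ord_max `^ (a - 1) != 0 by rewrite gt_eqF // powR_gt0.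
move=> h; apply: (mulfI w0); rewrite mulr0 -[RHS]h /=; ring.
Qed.

(** The continuous extension of the normal derivative is bounded near x, and the
    mean value theorem applies on the normal segment because u is continuous up
    to its end. *)
Lemma C1_boundary_lipschitz u : C1_closure (half_space R n) u -> boundary_lipschitz u.
Proof.
move=> [[_ hC] cu hext] x xm; have [g cg hg] := hext ord_max.
rewrite closure_half_space in cu cg.
have hx : closed_half_space R n x by rewrite /closed_half_space /= xm.
have line_in t : 0 < t -> half_space R n (x + t *: axis ord_max).
  by move=> t0; rewrite /half_space /= mxE axisE eqxx xm add0r.
have line_cl t : 0 <= t -> closed_half_space R n (x + t *: axis ord_max).
  by move=> t0; rewrite /closed_half_space /= mxE axisE eqxx xm add0r.
have cl : continuous (fun t : R => x + t *: axis ord_max : 'rV[R]_n.+1).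
  move=> t; have c1 : {for t, continuous (fun t : R => t *: axis ord_max : 'rV[R]_n.+1)}.
    exact: (@continuousZr_tmp R 'rV[R]_n.+1 R (fun t : R => t) _ t (fun A hA => hA)).
  have c0 : {for t, continuous (fun _ : R => x)} by exact: cst_continuous.
  exact: (continuousD c0 c1).
have within_line (f : 'rV[R]_n.+1 -> R) : {within closed_half_space R n, continuous f} ->
    {within [set t : R | 0 <= t], continuous (fun t => f (x + t *: axis ord_max))}.
  move=> /subspace_continuousP cf; apply/subspace_continuousP => t t0.
  have := cf _ (line_cl t t0); apply: cvg_comp => P; rewrite /within /= => /(cl t).
  by apply: (@filterS _ (nbhs t)) => s hs s0; apply: hs; exact: line_cl.
have := within_line g cg => /subspace_continuousP/(_ 0 (lexx _)).
rewrite /from_subspace /= scale0r addr0 => /(@cvgrPdist_lt R R)/(_ 1 ltr01).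
rewrite /within /= => /nbhs_ballP[d /= d0 hd].
exists (`|g x| + 1), d; split=> // t t0 td.
have du (s : R) : 0 < s -> is_derive s 1 (fun s => u (x + s *: axis ord_max))
    (partial ord_max u (x + s *: axis ord_max)).
  move=> s0; apply/is_derive_line; apply: derivableP.
  by apply: (hC ord_max).1; rewrite inE; exact: line_in.
have [||c] := @MVT _ (fun s => u (x + s *: axis ord_max))
    (fun s => partial ord_max u (x + s *: axis ord_max)) 0 t t0.
- by move=> s; rewrite in_itv /= => /andP[s0 _]; exact: du.
- apply: continuous_subspaceW (within_line u cu) => s /=.
  by rewrite in_itv /= => /andP[].
rewrite in_itv /= subr0 scale0r addr0 => /andP[c0 ct] ->.
rewrite normrM (gtr0_norm t0) ler_wpM2r ?(ltW t0) //.
rewrite hg; last by rewrite inE; exact: line_in.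
have : `|g x - g (x + c *: axis ord_max)| < 1.
  apply: hd (ltW c0); rewrite -ball_normE /= sub0r normrN gtr0_norm //.
  exact: lt_trans td.
rewrite distrC => /ltW h.
rewrite -[X in `|X|](subrK (g x)) addrC.
exact: le_trans (ler_normD _ _) (lerD (lexx _) h).
Qed.

Lemma solution_ge0 u : {within closed_half_space R n, continuous u} ->
  boundary_lipschitz u -> (forall x, half_space R n x -> 0 < u x) ->
  forall x, closed_half_space R n x -> 0 <= u x.
Proof.
move=> cu lip pos x hx; have [xm|xm] := eqVneq (x 0 ord_max) 0; last first.
  by apply/ltW/pos; rewrite /half_space /= lt0r xm.
rewrite leNgt; apply/negP => ux; have [G [d [d0 hG]]] := lip x xm.
have G1 : 0 < `|G| + 1 by rewrite ltr_pwDr.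
have q0 : 0 < - u x / (`|G| + 1) by rewrite divr_gt0 // oppr_gt0.
pose t := Num.min d (- u x / (`|G| + 1)) / 2.
have t0 : 0 < t by rewrite divr_gt0 // lt_min d0.
have td : t < d.
  by rewrite ltr_pdivrMr // (@le_lt_trans _ _ d) ?ge_min ?lexx // ltr_pMr // ltr1n.
have tq : t * (`|G| + 1) <= - u x.
  rewrite -ler_pdivlMr // ler_pdivrMr // (@le_trans _ _ (- u x / (`|G| + 1))) //.
    by rewrite ge_min lexx orbT.
  by rewrite ler_peMr ?ltW // ltr1n.
have p : 0 < u (x + t *: axis ord_max).
  by apply: pos; rewrite /half_space /= mxE axisE eqxx xm add0r.
have := hG t t0 td; rewrite gtr0_norm; last by rewrite subr_gt0 (lt_trans ux).
have : G * t <= `|G| * t by rewrite ler_wpM2r ?ler_norm // ltW.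
lra.
Qed.

End classical_solutions.

Theorem corollary1p3 (R : realType) (n : nat) (hn : (2 <= n.+1)%N)
    (a : R) (ha0 : 0 < a) (ha1 : a < 1) (u : 'rV[R]_n.+1 -> R)
    (hC2 : Ck 2 (half_space R n) u) (hC1 : C1_closure (half_space R n) u)
    (heq : forall x, half_space R n x ->
       div (fun y => (y 0 ord_max `^ a) *: grad u y) x = 0)
    (hpos : forall x, half_space R n x -> 0 < u x) :
  exists2 C : R, 0 < C & forall x, closed_half_space R n x -> u x = C.
Proof.
have lip := C1_boundary_lipschitz u hC1.
have cu : {within closed_half_space R n, continuous u}.
  by case: hC1 => _ + _; rewrite closure_half_space.
have nonneg := solution_ge0 u cu lip hpos.
have le := liouville_le a u ha0 ha1 (C2_wharmonic a u hC2 heq) cu nonneg lip.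
have h1 : half_space R n (axis ord_max).
  by rewrite /half_space /= !mxE !eqxx ltr01.
exists (u (axis ord_max)); first exact: hpos.
by move=> x hx; apply/eqP; rewrite eq_le !le //; exact: ltW.
Qed.
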